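(* Let $p$ be a prime, $N\in\mathbb N$, and let $T$ be an $N$-valid tree on $V=\{0,\dots,p-1\}$. Choose complex numbers $\lambda_{\alpha_{-N},\dots,\alpha_0}$, $\alpha_{-N},\dots,\alpha_0\in\{0,\dots,p-1\}$, with $\lambda_{0,0,\dots,0}=1$ and, for $(\alpha_{-N},\dots,\alpha_0)\ne(0,\dots,0)$, $|\lambda_{\alpha_{-N},\dots,\alpha_0}|=1$ if $T$ contains a directed path with successive labels $\alpha_0\to\alpha_{-1}\to\dots\to\alpha_{-N}$ and $\lambda_{\alpha_{-N},\dots,\alpha_0}=0$ otherwise. Let $m_0:X\to\mathbb C$ be the function with $m_0(\mathfrak G_{-N}^\bot r_{-N}^{\alpha_{-N}}\cdots r_{-1}^{\alpha_{-1}}r_0^{\alpha_0})=\lambda_{\alpha_{-N},\dots,\alpha_0}$ on $\mathfrak G_1^\bot$, extended to $X$ by $m_0(\chi r_1^{\alpha_1}\cdots r_s^{\alpha_s})=m_0(\chi)$ for all $s\in\mathbb N$, $\alpha_j\in\{0,\dots,p-1\}$. Let $\varphi\in L_2(\mathfrak G)$ have Fourier transform $\hat\varphi(\chi)=\prod_{n=0}^\infty m_0(\chi\mathcal A^{-n})$. Let $(\beta_h)_{h\in H_0^{(N+1)}}$ be the (unique) coefficients with $$m_0(\chi)=\frac1p\sum_{h\in H_0^{(N+1)}}\beta_h\overline{(\chi\mathcal A^{-1},h)}\qquad(\chi\in X),$$ and for $l=1,\dots,p-1$ set $\beta_h^{(l)}=\beta_h\,(r_0^l,\mathcal A^{-1}h)$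 (so that $m_l(\chi):=m_0(\chi r_0^{-l})=\frac1p\sum_{h\in H_0^{(N+1)}}\beta_h^{(l)}\overline{(\chi,\mathcal A^{-1}h)}$) and $$\psi_l(x)=\sum_{h\in H_0^{(N+1)}}\beta_h^{(l)}\varphi(\mathcal Ax\dot-h).$$ For $n\in\mathbb Z$ let $V_n$ be the closed linear span of $(\varphi(\mathcal A^nx\dot-h))_{h\in H_0}$ in $L_2(\mathfrak G)$, and let $W_0$ be the orthogonal complement of $V_0$ in $V_1$. Then the functions $\psi_l(x\dot-h)$, $l=1,\dots,p-1$, $h\in H_0$, form an orthonormal basis of $W_0$.
   Context: **Group.** $\mathfrak G$ (the $p$-adic Vilenkin group, operation $\dot+$, subtraction $\dot-$) is the group of sequences $x=(x_n)_{n\in\mathbb Z}$, $x_n\in\{0,\dots,p-1\}$, with only finitely many nonzero terms of negative index, added coordinatewise modulo $p$. Put $\mathfrak G_n=\{x: x_k=0 \text{ for } k<n\}$; these subgroups form a base of neighbourhoods of $0$. $g_n$ is the sequence with $1$ at place $n$ and $0$ elsewhere, so $x=\sum_n x_ng_n$ and $pg_n=0$. $\mu$ is the Haar measure with $\mu(\mathfrak G_n)=p^{-n}$. The dilation operator is $\mathcal A\bigl(\sum_n a_ng_n\bigr)=\sum_n a_ng_{n-1}$. $H_0=\{a_{-1}g_{-1}\dot+\dots\dot+a_{-s}g_{-s}: s\in\mathbb N,\ a_j\in\{0,\dots,p-1\}\}$ and, for fixed $s$, $H_0^{(s)}=\{a_{-1}g_{-1}\dot+\dots\dot+a_{-s}g_{-s}: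 a_j\in\{0,\dots,p-1\}\}$. **Characters.** $X$ is the multiplicative group of continuous characters of $\mathfrak G$; $(\chi,x)$ is the value of $\chi$ at $x$; $\mathfrak G_n^\bot=\{\chi\in X:(\chi,x)=1\ \forall x\in\mathfrak G_n\}$; $\nu$ is the Haar measure on $X$ with $\nu(\mathfrak G_n^\bot)=p^n$. The Fourier transform on $L_2(\mathfrak G)$ is $\hat f(\chi)=\int_{\mathfrak G}f(x)\overline{(\chi,x)}\,d\mu(x)$ (in the $L_2$ sense), with inverse $f(x)=\int_X\hat f(\chi)(\chi,x)\,d\nu(\chi)$. The Rademacher characters are $(r_n,\sum_k a_kg_k)=\exp(2\pi i a_n/p)$, so $r_n\in\mathfrak G_{n+1}^\bot\setminus\mathfrak G_n^\bot$. $\chi\mathcal A^{\pm1}$ is defined by $(\chi\mathcal A^{\pm1},x)=(\chi,\mathcal A^{\pm1}x)$ (so $r_n\mathcal A=r_{n+1}$). **$N$-valid tree.** A rooted tree with vertices labelled by elements of $V=\{0,\dots,p-1\}$ (a label may occur at several vertices), edges directed away from the root, such that (1) the root and all vertices of levels $1,\dots,N-1$ have label $0$ (so the tree starts with a single chain of $N$ zeros; the root has level $0$); (2) for every $(\alpha_1,\dots,\alpha_N)\in V^N$ there is exactly one directed path of $N$ vertices in the tree whose successive labels are $\alpha_1\to\alpha_2\to\dots\to\alpha_N$. *)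

(* Defs.v *)
From HB Require Import structures.
From mathcomp Require Import all_boot all_order all_algebra.
From mathcomp Require Import all_classical all_reals all_analysis.
From mathcomp Require Import complex.

Set Implicit Arguments.
Unset Strict Implicit.
Unset Printing Implicit Defensive.

Import Order.TTheory GRing.Theory Num.Theory.
Import numFieldNormedType.Exports.

Local Open Scope classical_set_scope.
Local Open Scope ring_scope.

(* R[i] is a numClosedFieldType, but the topology that the library puts on
   such fields is not found by unification for this concrete type. *)
HB.instance Definition _ (R : realType) :=
  PseudoPointedMetric.copy R[i] (R[i]^o).

Definition finneg_pred (p : nat) (x : int -> 'Z_p) : bool :=
  `[< finite_set [set k : int | (k < 0) && (x k != 0)] >].
Definition finneg (p : nat) : {pred int -> 'Z_p} := @finneg_pred p.
Arguments finneg p : clear implicits.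

Lemma finnegP (p : nat) (x : int -> 'Z_p) :
  reflect (exists m : int, forall k, k < m -> x k = 0) (x \in finneg p).
Proof.
apply: (iffP (asboolP _)) => [/finite_seqP[s sE]|[m xm]].
  exists (- (\sum_(k <- s) `|k| + 1)) => k kl; apply/eqP/negPn/negP => xk.
  have ks : k \in s.
    suff : [set` s] k by [].
    rewrite -sE /= xk andbT (lt_trans kl)// oppr_lt0 ltr_wpDl//.
    by apply: sumr_ge0 => *.
  move: kl; rewrite (big_rem _ ks)/= ltNge => /negP; apply.
  rewrite lerNl (le_trans (ler_norm _))// normrN -addrA lerDl.
  by rewrite addr_ge0// sumr_ge0.
apply: (@sub_finite_set _ _ ((fun i : nat => m + i%:Z) @` `I_(`|m|)%N)); last first.
  exact/finite_image/finite_II.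
move=> k /= /andP[k0 xk].
have mk : m <= k by rewrite leNgt; apply: contraNN xk => /xm ->.
exists `|k - m|%N; last by rewrite /= gez0_abs ?subr_ge0// subrKC.
rewrite -ltz_nat gez0_abs ?subr_ge0// ltz0_abs; last exact: le_lt_trans k0.
by rewrite -[ltRHS]add0r ltrD2r.
Qed.

Lemma finneg_zmod_closed (p : nat) : zmod_closed (finneg p).
Proof.
split=> [|x y /finnegP[m xm] /finnegP[n yn]].
  by apply/finnegP; exists 0.
apply/finnegP; exists (Order.min m n) => k; rewrite lt_min => /andP[km kn].
by have -> : (x - y) k = x k - y k by []; rewrite xm// yn// subr0.
Qed.
HB.instance Definition _ (p : nat) :=
  GRing.isZmodClosed.Build (int -> 'Z_p) (finneg p) (finneg_zmod_closed p).

(* As 'Z_p is the ring of integers modulo p only when 1 < p, so is the group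
   below the p-adic Vilenkin group only when 1 < p. *)
Record vilenkin (p : nat) := Vilenkin {
  digit :> int -> 'Z_p ;
  _ : digit \in finneg p }.

HB.instance Definition _ (p : nat) := [isSub for @digit p].
HB.instance Definition _ (p : nat) := [Choice of vilenkin p by <:].
HB.instance Definition _ (p : nat) :=
  [SubChoice_isSubZmodule of vilenkin p by <:].
HB.instance Definition _ (p : nat) := isPointed.Build (vilenkin p) 0.

Section Vilenkin.
Variable p : nat.
Implicit Types (x y : vilenkin p) (n k : int).

Lemma vilenkinP x y : (forall k, x k = y k) -> x = y.
Proof. by move=> xy; apply/val_inj/funext. Qed.

Lemma digitD x y k : (x + y) k = x k + y k. Proof. by []. Qed.
Lemma digitB x y k : (x - y) k = x k - y k. Proof. by []. Qed.
Lemma digit0 k : (0 : vilenkin p) k = 0. Proof. by []. Qed.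

Definition subG n : set (vilenkin p) := [set x | forall k, k < n -> x k = 0].

Lemma subG_le m n : m <= n -> subG n `<=` subG m.
Proof. by move=> mn x xn k km; apply: xn; exact: lt_le_trans mn. Qed.

Definition gen_fun n : int -> 'Z_p := fun k => (k == n)%:R.
Fact gen_subproof n : gen_fun n \in finneg p.
Proof. by apply/finnegP; exists n => k kn; rewrite /gen_fun lt_eqF. Qed.
Definition gen n : vilenkin p := Vilenkin (gen_subproof n).

(* The n-th power of the dilation operator, for any integer n. *)
Definition dil_fun n x : int -> 'Z_p := fun k => x (k + n).
Fact dil_subproof n x : dil_fun n x \in finneg p.
Proof.
have /finnegP[m xm] := valP x.
by apply/finnegP; exists (m - n) => k km; apply: xm; rewrite -ltrBrDr.
Qed.
Definition dil n x : vilenkin p := Vilenkin (dil_subproof n x).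

Lemma dil0 x : dil 0 x = x.
Proof. by apply: vilenkinP => k /=; rewrite /dil_fun addr0. Qed.

Lemma dil_add m n x : dil (m + n) x = dil m (dil n x).
Proof. by apply: vilenkinP => k /=; rewrite /dil_fun /= /dil_fun addrA. Qed.

Lemma dilD n x y : dil n (x + y) = dil n x + dil n y.
Proof. exact: vilenkinP. Qed.

Lemma dil1_gen n : dil 1 (gen n) = gen (n - 1).
Proof.
apply: vilenkinP => k; rewrite /= /dil_fun /= /gen_fun.
by rewrite -(inj_eq (addIr (-1)) (k + 1)) addrK.
Qed.

Definition H0s (s : nat) : set (vilenkin p) :=
  range (fun a : {ffun 'I_s -> 'Z_p} =>
    \sum_(j < s) gen (- j.+1%:Z) *+ a j).

Definition H0 : set (vilenkin p) := \bigcup_s H0s s.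

Lemma finite_H0s s : finite_set (H0s s).
Proof. exact/finite_image/finite_finset. Qed.

Definition openG : set_system (vilenkin p) :=
  [set U | forall x, U x -> exists n, forall y, subG n y -> U (x + y)].

Lemma openG_T : openG setT. Proof. by move=> x _; exists 0. Qed.

Lemma openG_I : setI_closed openG.
Proof.
move=> U V oU oV x [Ux Vx]; have [m Um] := oU x Ux; have [n Vn] := oV x Vx.
exists (Order.max m n) => y yn; split.
  by apply: Um; apply: subG_le yn; rewrite le_max lexx.
by apply: Vn; apply: subG_le yn; rewrite le_max lexx orbT.
Qed.

Lemma openG_bigU (I : Type) (f : I -> set (vilenkin p)) :
  (forall i, openG (f i)) -> openG (\bigcup_i f i).
Proof.
move=> of_ x [i _ fx]; have [n fn] := of_ i x fx.
by exists n => y yn; exists i => //; exact: fn.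
Qed.

HB.instance Definition _ :=
  isOpenTopological.Build (vilenkin p) openG_T openG_I openG_bigU.

HB.instance Definition _ :=
  @isMeasurable.Build (sigma_display (@open (vilenkin p))) (vilenkin p)
    <<s @open (vilenkin p) >> (@sigma_algebra0 _ setT _)
    (@sigma_algebraC _ _) (@sigma_algebra_bigcup _ setT _).

Lemma nbhs_subG x (A : set (vilenkin p)) n :
  (forall y, subG n y -> A (x + y)) -> nbhs x A.
Proof.
move=> xA; exists [set x + y | y in subG n]; split.
- move=> _ [y yn <-]; exists n => z zn; exists (y + z); rewrite ?addrA//.
  by move=> k kn; rewrite digitD yn// zn// addr0.
- by exists 0; rewrite ?addr0.
- by move=> _ [y yn <-]; exact: xA.
Qed.

Lemma nbhs_subGP x (A : set (vilenkin p)) :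
  nbhs x A <-> exists n, forall y, subG n y -> A (x + y).
Proof.
split=> [[U [oU Ux UA]]|[n]]; last exact: nbhs_subG.
by have [n Un] := oU x Ux; exists n => y yn; apply/UA/Un.
Qed.

Lemma continuous_dil n : continuous (dil n).
Proof.
move=> x A /nbhs_subGP[m xA]; apply/nbhs_subGP; exists (m + n) => y ym /=.
by rewrite /= dilD; apply: xA => k km; apply: ym; rewrite ltrD2r.
Qed.

Lemma locally_cst_continuous (T : topologicalType) (f : vilenkin p -> T) n :
  (forall x y, subG n y -> f (x + y) = f x) -> continuous f.
Proof.
move=> fn x A /nbhs_singleton Ax; apply/nbhs_subGP.
by exists n => y yn /=; rewrite fn.
Qed.

End Vilenkin.
Arguments subG : clear implicits.
Arguments gen : clear implicits.
Arguments H0s : clear implicits.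
Arguments H0 : clear implicits.

Definition is_character (R : realType) (p : nat) (f : vilenkin p -> R[i]) :=
  [/\ forall x, `|f x| = 1, forall x y, f (x + y) = f x * f y & continuous f].

Record character (R : realType) (p : nat) := Character {
  pairing :> vilenkin p -> R[i] ;
  characterP : is_character pairing }.

HB.instance Definition _ (R : realType) (p : nat) :=
  gen_eqMixin (character R p).
HB.instance Definition _ (R : realType) (p : nat) :=
  gen_choiceMixin (character R p).

Definition expi (R : realType) (t : R) : R[i] := (cos t +i* sin t)%C.

Lemma expi_norm (R : realType) (t : R) : `|expi t| = 1.
Proof. by rewrite normc_def /= cos2Dsin2 sqrtr1. Qed.

Lemma expiD (R : realType) (s t : R) : expi (s + t) = expi s * expi t.
Proof.
by rewrite /expi cosD sinD; apply/eqP; rewrite eq_complex/= eqxx/= addrC mulrC.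
Qed.

Section Character.
Variables (R : realType) (p : nat).
Implicit Types (chi : character R p) (x y : vilenkin p) (n k : int).

Lemma eq_character chi chi' : (forall x, chi x = chi' x) -> chi = chi'.
Proof.
case: chi chi' => [f fP] [g gP] /= /funext fg; move: fP gP; rewrite fg => fP gP.
by congr Character; exact: Prop_irrelevance.
Qed.

Lemma character_neq0 chi x : chi x != 0.
Proof. by case: (characterP chi) => c1 _ _; rewrite -normr_eq0 c1 oner_eq0. Qed.

Fact one_subproof : @is_character R p (fun=> 1).
Proof. by split=> [x|x y|]; rewrite ?normr1 ?mulr1//; exact: cst_continuous. Qed.

Fact mul_subproof chi chi' : is_character (fun x => chi x * chi' x).
Proof.
case: (characterP chi) (characterP chi') => [c1 cD cc] [c1' cD' cc'].
split=> [x|x y|x]; first by rewrite normrM c1 c1' mulr1.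
  by rewrite cD cD' mulrACA.
exact: (@cvgM (R[i] : numFieldType) _ (nbhs x) _ chi chi' _ _ (cc x) (cc' x)).
Qed.

Fact inv_subproof chi : is_character (fun x => (chi x)^-1).
Proof.
case: (characterP chi) => [c1 cD cc].
split=> [x|x y|x]; first by rewrite normfV c1 invr1.
  by rewrite cD invfM.
exact: (@cvgV (R[i] : numFieldType) _ (nbhs x) _ chi _ (character_neq0 chi x)
  (cc x)).
Qed.

Definition char_one := Character one_subproof.
Definition char_mul chi chi' := Character (mul_subproof chi chi').
Definition char_inv chi := Character (inv_subproof chi).

Fact char_mulA : associative char_mul.
Proof. by move=> a b c; apply: eq_character => x /=; rewrite mulrA. Qed.
Fact char_mul1 : left_id char_one char_mul.
Proof. by move=> a; apply: eq_character => x /=; rewrite mul1r. Qed.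
Fact char_mulr1 : right_id char_one char_mul.
Proof. by move=> a; apply: eq_character => x /=; rewrite mulr1. Qed.
Fact char_mulV : left_inverse char_one char_inv char_mul.
Proof. by move=> a; apply: eq_character => x /=; rewrite mulVf ?character_neq0. Qed.
Fact char_mulrV : right_inverse char_one char_inv char_mul.
Proof. by move=> a; apply: eq_character => x /=; rewrite mulfV ?character_neq0. Qed.

HB.instance Definition _ := isGroup.Build (character R p)
  char_mulA char_mul1 char_mulr1 char_mulV char_mulrV.
HB.instance Definition _ := isPointed.Build (character R p) 1%g.

Lemma character1 x : (1%g : character R p) x = 1. Proof. by []. Qed.
Lemma characterM chi chi' x : (chi * chi')%g x = chi x * chi' x.
Proof. by []. Qed.
Lemma characterV chi x : (chi^-1)%g x = (chi x)^-1. Proof. by []. Qed.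

Definition annih n : set (character R p) :=
  [set chi | forall x, subG p n x -> chi x = 1].

Lemma annih_le m n : m <= n -> annih m `<=` annih n.
Proof. by move=> mn chi chim x /(subG_le mn) /chim. Qed.

(* The modulus (Zp_trunc p).+2 of 'Z_p is p as soon as 1 < p. *)
Definition rad_fun n : vilenkin p -> R[i] :=
  fun x => expi (2 * pi * (x n : nat)%:R / (Zp_trunc p).+2%:R).

Fact rad_subproof n : is_character (rad_fun n).
Proof.
set q := (Zp_trunc p).+2; have q0 : q%:R != 0 :> R by rewrite pnatr_eq0.
have radD x y : rad_fun n (x + y) = rad_fun n x * rad_fun n y.
  rewrite /rad_fun -expiD -mulrDl -mulrDr -natrD digitD /= -/q.
  set m := (x n + y n)%N.
  have -> : 2 * pi * m%:R / q%:R =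
      2 * pi * (m %% q)%N%:R / q%:R + pi *+ 2 *+ (m %/ q) :> R.
    rewrite {1}(divn_eq m q) addnC natrD mulrDr mulrDl natrM mulrA mulfK//.
    by rewrite -(mulr_natl pi 2) [_ * (_ %/ _)%:R]mulr_natr.
  by rewrite /expi (periodicn (@cosD2pi R)) (periodicn (@sinD2pi R)).
split=> [x||]; [exact: expi_norm|exact: radD|].
apply: (@locally_cst_continuous _ _ _ (n + 1)) => x y yn.
by rewrite /rad_fun digitD yn ?addr0// ltrDl.
Qed.
Definition rad n : character R p := Character (rad_subproof n).

Fact chi_dil_subproof n chi : is_character (fun x => chi (dil n x)).
Proof.
case: (characterP chi) => [c1 cD cc].
split=> [x|x y|x]; [exact: c1|by rewrite dilD cD|].
by apply: continuous_comp; [exact: continuous_dil|exact: cc].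
Qed.
Definition chi_dil n chi : character R p := Character (chi_dil_subproof n chi).

(* The annihilators form a base of neighbourhoods of 1. As the subgroups subG n
   are open, compact and exhaust the group, this is the compact-open topology. *)
Definition openX : set_system (character R p) :=
  [set U | forall chi, U chi ->
     exists n, forall xi, annih n xi -> U (chi * xi)%g].

Lemma openX_T : openX setT. Proof. by move=> chi _; exists 0. Qed.

Lemma openX_I : setI_closed openX.
Proof.
move=> U V oU oV x [Ux Vx]; have [m Um] := oU x Ux; have [n Vn] := oV x Vx.
exists (Order.min m n) => y yn; split.
  by apply: Um; apply: annih_le yn; rewrite ge_min lexx.
by apply: Vn; apply: annih_le yn; rewrite ge_min lexx orbT.
Qed.

Lemma openX_bigU (I : Type) (f : I -> set (character R p)) :
  (forall i, openX (f i)) -> openX (\bigcup_i f i).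
Proof.
move=> of_ x [i _ fx]; have [n fn] := of_ i x fx.
by exists n => y yn; exists i => //; exact: fn.
Qed.

HB.instance Definition _ :=
  isOpenTopological.Build (character R p) openX_T openX_I openX_bigU.

HB.instance Definition _ :=
  @isMeasurable.Build (sigma_display (@open (character R p))) (character R p)
    <<s @open (character R p) >> (@sigma_algebra0 _ setT _)
    (@sigma_algebraC _ _) (@sigma_algebra_bigcup _ setT _).

End Character.
Arguments annih : clear implicits.
Arguments rad : clear implicits.

(* Both groups carry their Borel sigma-algebra. Translation invariance and the
   normalization determine the Haar measure. *)
Definition haar_vilenkin (R : realType) (p : nat)
    (mu : {measure set (vilenkin p) -> \bar R}) :=
  (forall x (A : set (vilenkin p)), measurable A ->
     mu [set x + y | y in A] = mu A) /\
  (forall n : int, mu (subG p n) = (p%:R ^ (- n))%:E).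

Definition haar_character (R : realType) (p : nat)
    (nu : {measure set (character R p) -> \bar R}) :=
  (forall chi (A : set (character R p)), measurable A ->
     nu [set (chi * xi)%g | xi in A] = nu A) /\
  (forall n : int, nu (annih R p n) = (p%:R ^ n)%:E).

Section L2.
Context (d : measure_display) (T : measurableType d) (R : realType).
Variable mu : {measure set T -> \bar R}.
Implicit Types (f g : T -> R[i]) (S W : set (T -> R[i])).

Definition cintegral (D : set T) f : R[i] :=
  ((\int[mu]_(x in D) complex.Re (f x))%R
     +i* (\int[mu]_(x in D) complex.Im (f x))%R)%C.

Definition cmeasurable f :=
  measurable_fun setT (fun x => complex.Re (f x)) /\
  measurable_fun setT (fun x => complex.Im (f x)).

Definition L2norm f : \bar R :=
  Lnorm mu 2%:E (fun x => (ComplexField.Normc.normc (f x))%:E).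

(* Elements of L_2 are represented by functions, without identifying those
   that are equal almost everywhere: all the notions below are invariant under
   almost everywhere equality. *)
Definition L2 : set (T -> R[i]) :=
  [set f | cmeasurable f /\ (L2norm f < +oo)%E].

Definition inner f g : R[i] := cintegral setT (fun x => f x * (g x)^*%C).

Definition linear_span S : set (T -> R[i]) :=
  [set f | exists (n : nat) (c : 'I_n -> R[i]) (u : 'I_n -> T -> R[i]),
     (forall i, S (u i)) /\ f = (fun x => \sum_(i < n) c i * u i x)].

Definition closed_span S : set (T -> R[i]) :=
  [set f | L2 f /\ forall eps : R, 0 < eps ->
     exists2 g, linear_span S g & (L2norm (fun x => (f x - g x)%R) < eps%:E)%E].

Definition ortho_compl W0 W1 : set (T -> R[i]) :=
  [set f | W1 f /\ forall g, W0 g -> inner f g = 0].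

Definition orthonormal_basis (I : eqType) (D : set I) (e : I -> T -> R[i]) W :=
  [/\ e @` D `<=` W,
      forall i j, D i -> D j -> inner (e i) (e j) = (i == j)%:R
    & closed_span (e @` D) = W].

End L2.

(* F is the Fourier transform of f: the L_2-limit of the integrals over the
   compact subgroups G_{-n} exhausting the group. *)
Definition is_fourier (R : realType) (p : nat)
    (mu : {measure set (vilenkin p) -> \bar R})
    (nu : {measure set (character R p) -> \bar R})
    (f : vilenkin p -> R[i]) (F : character R p -> R[i]) :=
  [/\ L2 mu f, L2 nu F &
      (fun n : nat => L2norm nu (fun chi =>
         F chi - cintegral mu (subG p (- n%:Z)) (fun x => f x * (chi x)^*%C)))
      @ \oo --> 0%E].

(* A rooted tree with edges directed away from the root: every vertex is
   reached from the root by exactly one directed path. *)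
Record ltree (V : Type) := LTree {
  tvertex : eqType ;
  troot : tvertex ;
  tedge : rel tvertex ;
  tlabel : tvertex -> V ;
  ltreeP : forall v, exists! s, path tedge troot s /\ last troot s = v }.

(* w is a directed path of the tree t, with successive labels s *)
Definition tree_path (V : Type) (t : ltree V) (s : seq V)
    (w : seq (tvertex t)) :=
  sorted (@tedge V t) w /\ map (@tlabel V t) w = s.

Definition level (V : Type) (t : ltree V) (v : tvertex t) (k : nat) :=
  exists s, [/\ path (@tedge V t) (troot t) s, last (troot t) s = v & size s = k].

(* The second condition says that the tree starts with a single chain of N
   vertices. A tree satisfying these conditions is necessarily finite. *)
Definition valid_tree (p N : nat) (t : ltree 'Z_p) :=
  [/\ forall (v : tvertex t) k, level v k -> (k < N)%N -> tlabel v = 0,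
      forall (v w : tvertex t) k, level v k -> level w k -> (k < N)%N -> v = w
    & forall a : N.-tuple 'Z_p, exists! w, tree_path (t := t) a w].

Section Wavelets.
Variables (R : realType) (p N : nat).

(* The indices are listed in the order of the paths of the tree:
   the j-th component of a is alpha_{-j}, for j = 0, ..., N. *)
Definition mask_values (t : ltree 'Z_p) (lam : N.+1.-tuple 'Z_p -> R[i]) :=
  lam [tuple of nseq N.+1 0] = 1 /\
  forall a : N.+1.-tuple 'Z_p, a != [tuple of nseq N.+1 0] ->
    ((exists w, tree_path (t := t) a w) -> `|lam a| = 1) /\
    (~ (exists w, tree_path (t := t) a w) -> lam a = 0).

Definition is_mask (lam : N.+1.-tuple 'Z_p -> R[i])
    (m0 : character R p -> R[i]) :=
  (forall (a : N.+1.-tuple 'Z_p) chi, annih R p (- N%:Z) chi ->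
     m0 (chi * \prod_(j < N.+1) rad R p (- j%:Z) ^+ tnth a j)%g = lam a) /\
  (forall (s : nat) (a : 'I_s -> 'Z_p) chi, annih R p 1 chi ->
     m0 (chi * \prod_(j < s) rad R p j.+1 ^+ a j)%g = m0 chi).

Definition scaling_hat (m0 : character R p -> R[i])
    (chi : character R p) : R[i] :=
  limn (fun k => \prod_(0 <= n < k) m0 (chi_dil (- n%:Z) chi)).

Definition mask_coefs (m0 : character R p -> R[i])
    (beta : vilenkin p -> R[i]) :=
  forall chi, m0 chi =
    p%:R^-1 * \sum_(h \in H0s p N.+1) beta h * (chi_dil (-1) chi h)^*%C.

Definition wavelet (beta phi : vilenkin p -> R[i]) (l : nat) :
    vilenkin p -> R[i] :=
  fun x => \sum_(h \in H0s p N.+1)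
    beta h * (rad R p 0 ^+ l)%g (dil (-1) h) * phi (dil 1 x - h).

Definition mra_space (mu : {measure set (vilenkin p) -> \bar R})
    (phi : vilenkin p -> R[i]) (n : int) : set (vilenkin p -> R[i]) :=
  closed_span mu [set (fun x => phi (dil n x - h)) | h in H0 p].

End Wavelets.

(* Main.v *)
(** The support of [hat phi] is governed by the tree: reading the digits
    [a_n, ..., a_(n-N)] of a character as a path, the nonvanishing of all the
    factors [m_0 (chi A^-n)] means that increasing [n] walks from a vertex towards
    the root. A vertex has one parent, so exactly one digit [a_0] extends given
    digits [a_(-1), ..., a_(-N)] with [m_0 <> 0], where [|m_0| = 1]; and the root is
    reached in boundedly many steps, so [phi] is almost everywhere a locally
    constant function of compact support, with orthonormal translates.

    The same property says that for every [chi] exactly one of the numbers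
    [m_0 (chi r_0^a)], [a < p], is nonzero, and has modulus 1. Hence the components
    of [m_0] along each residue class of frequencies are unimodular up to the factor
    [1/p], which is equivalent to the coefficients [beta_h^(l)], [l < p], forming a
    unitary system that transforms the basis [phi (A x - h)] of [V_1] into the
    functions [psi_l (x - h)], [l < p], where [psi_0 = phi].

    The Haar measures enter through their values on cosets of the [G_n], which
    generate the Borel sets: a function of [L_2] is null as soon as its Fourier
    coefficients over all large [G_(-m)] vanish. The coefficients of [phi] over
    [G_(-m)], [m >= N], equal [hat phi] exactly, and not only in the limit, because
    averaging makes the distance to [hat phi] monotone in [m]. *)
Require Import Defs.
From HB Require Import structures.
From mathcomp Require Import all_boot all_order all_algebra.
From mathcomp Require Import all_classical all_reals all_analysis.
From mathcomp Require Import complex.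
From mathcomp Require Import measurable_realfun.
From mathcomp Require Import ring lra zify.
(* sesquilinear also defines a [rad]. *)
Import Defs.

Set Implicit Arguments.
Unset Strict Implicit.
Unset Printing Implicit Defensive.

Import Order.TTheory GRing.Theory Num.Theory.
Import numFieldNormedType.Exports.

Local Open Scope classical_set_scope.
Local Open Scope ring_scope.

(** * Square-integrable complex functions *)

Section NormSq.
Variable R : realType.
Implicit Types z w : R[i].

(** A real polynomial in the two parts of [z]: measurability is immediate and inequalities become
    real arithmetic. *)
Definition normsq z : R := complex.Re z ^+ 2 + complex.Im z ^+ 2.

Lemma normsq_ge0 z : 0 <= normsq z.
Proof. by rewrite addr_ge0 ?sqr_ge0. Qed.

Lemma normsqM z w : normsq (z * w) = normsq z * normsq w.
Proof. by case: z w => [a b] [c d]; rewrite /normsq /=; ring. Qed.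

Lemma normsq_conj z : normsq z^*%C = normsq z.
Proof. by case: z => [a b]; rewrite /normsq /= sqrrN. Qed.

Lemma mul_conjE z : z * z^*%C = (normsq z)%:C%C.
Proof.
by case: z => [a b]; apply/eqP; rewrite eq_complex /normsq /=; apply/andP; split;
  apply/eqP; ring.
Qed.

Lemma normsqE z : (normsq z)%:C%C = `|z| ^+ 2.
Proof. by rewrite sqr_normc mul_conjE. Qed.

Lemma normc_normsq z : ComplexField.Normc.normc z ^+ 2 = normsq z.
Proof. by case: z => a b; rewrite /= sqr_sqrtr// addr_ge0 ?sqr_ge0. Qed.

Lemma normsq_eq0 z : (normsq z == 0) = (z == 0).
Proof.
by rewrite -(inj_eq (@complexI R)) normsqE expf_eq0 /= normr_eq0.
Qed.

Lemma normsq1 z : `|z| = 1 -> normsq z = 1.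
Proof. by move=> z1; apply: (@complexI R); rewrite normsqE z1 expr1n. Qed.

Lemma normsqD_le z w : normsq (z + w) <= 2 * normsq z + 2 * normsq w.
Proof.
case: z w => [a b] [c d]; rewrite /normsq /=.
have := sqr_ge0 (a - c); have := sqr_ge0 (b - d); nra.
Qed.

Lemma normsqDge0 z w : 0 <= normsq z + normsq w.
Proof. by apply: addr_ge0; exact: normsq_ge0. Qed.

Lemma Re_mul_le z w : `|complex.Re (z * w)| <= normsq z + normsq w.
Proof.
case: z w => [a b] [c d]; rewrite /normsq /= ler_norml; apply/andP; split;
have := sqr_ge0 (a - c); have := sqr_ge0 (b - d);
have := sqr_ge0 (a + c); have := sqr_ge0 (b + d); nra.
Qed.

Lemma Im_mul_le z w : `|complex.Im (z * w)| <= normsq z + normsq w.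
Proof.
case: z w => [a b] [c d]; rewrite /normsq /= ler_norml; apply/andP; split;
have := sqr_ge0 (a - d); have := sqr_ge0 (b - c);
have := sqr_ge0 (a + d); have := sqr_ge0 (b + c); nra.
Qed.

Lemma mulC_conj z w : (z * w^*%C)^*%C = w * z^*%C.
Proof. by rewrite rmorphM /= conjcK mulrC. Qed.

End NormSq.

Section L2theory.
Context (d : measure_display) (T : measurableType d) (R : realType).
Variable mu : {measure set T -> \bar R}.
Implicit Types (f g h : T -> R[i]).

(** The square of [L2norm], free of the fractional power; [L2norm_lty] and [L2norm_lt] translate
    between the two. *)
Definition sqint f : \bar R := (\int[mu]_x (normsq (f x))%:E)%E.

Lemma L2normE f : L2norm mu f = (sqint f `^ 2^-1)%E.
Proof.
rewrite /L2norm unlock /sqint; congr (_ `^ _)%E.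
apply: eq_integral => x _ /=; rewrite -normc_normsq.
have n0 : 0 <= ComplexField.Normc.normc (f x) by case: (f x) => a b; exact: sqrtr_ge0.
by rewrite ger0_norm// powR_mulrn.
Qed.

Lemma sqint_ge0 f : (0 <= sqint f)%E.
Proof. by apply: integral_ge0 => x _; rewrite lee_fin normsq_ge0. Qed.

Lemma L2norm_lty f : (L2norm mu f < +oo)%E = (sqint f < +oo)%E.
Proof.
rewrite L2normE; have := sqint_ge0 f; case: (sqint f) => [r| |]// r0.
  by rewrite poweR_EFin !ltry.
by rewrite poweRyr// ?ltxx// invr_eq0.
Qed.

Lemma L2norm_lt f (e : R) : 0 < e ->
  (L2norm mu f < e%:E)%E = (sqint f < (e ^+ 2)%:E)%E.
Proof.
move=> e0; rewrite L2normE; have := sqint_ge0 f.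
case: (sqint f) => [r| |]//; rewrite ?lee_fin => r0.
  rewrite poweR_EFin !lte_fin -[RHS](ltr_sqrt r) ?exprn_gt0//.
  by rewrite sqrtr_sqr gtr0_norm// powR12_sqrt.
by rewrite poweRyr// invr_eq0.
Qed.

Lemma L2P f : L2 mu f <-> cmeasurable f /\ (sqint f < +oo)%E.
Proof. by rewrite /L2 /= L2norm_lty. Qed.

Lemma cmeasurable_normsq f : cmeasurable f ->
  measurable_fun setT (fun x => normsq (f x)).
Proof.
move=> [mr mi]; apply: measurable_funD;
  exact: measurable_funX.
Qed.

Lemma cmeasurableD f g : cmeasurable f -> cmeasurable g ->
  cmeasurable (fun x => f x + g x).
Proof.
move=> [fr fi] [gr gi]; split.
  by under eq_fun do rewrite raddfD; exact: measurable_funD.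
by under eq_fun do rewrite raddfD; exact: measurable_funD.
Qed.

Lemma cmeasurable_cst (z : R[i]) : cmeasurable (fun _ : T => z).
Proof. by split; exact: measurable_cst. Qed.

Lemma cmeasurableM f g : cmeasurable f -> cmeasurable g ->
  cmeasurable (fun x => f x * g x).
Proof.
move=> [fr fi] [gr gi]; split.
  rewrite (_ : (fun _ => _) = (fun x => complex.Re (f x) * complex.Re (g x)
     - complex.Im (f x) * complex.Im (g x))).
    by apply: measurable_funB; exact: measurable_funM.
  by apply/funext => x; case: (f x) (g x) => [a b] [].
rewrite (_ : (fun _ => _) = (fun x => complex.Re (f x) * complex.Im (g x)
     + complex.Im (f x) * complex.Re (g x))).
  by apply: measurable_funD; exact: measurable_funM.
by apply/funext => x; case: (f x) (g x) => [a b] [].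
Qed.

Lemma cmeasurable_conj f : cmeasurable f -> cmeasurable (fun x => (f x)^*%C).
Proof.
move=> [fr fi]; split.
  by rewrite (_ : (fun _ => _) = (fun x => complex.Re (f x)))//; apply/funext => x; case: (f x).
rewrite (_ : (fun _ => _) = (fun x => - complex.Im (f x))).
  exact: measurable_funN.
by apply/funext => x; case: (f x).
Qed.

Lemma L2D f g : L2 mu f -> L2 mu g -> L2 mu (fun x => f x + g x).
Proof.
move=> /L2P[mf fy] /L2P[mg gy]; apply/L2P; split; first exact: cmeasurableD.
pose b x := (2 * normsq (f x) + 2 * normsq (g x))%:E.
have mnf := cmeasurable_normsq mf; have mng := cmeasurable_normsq mg.
apply: (@le_lt_trans _ _ (\int[mu]_x b x)%E).
  apply: ge0_le_integral => //.
  - by move=> x _; rewrite lee_fin normsq_ge0.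
  - by apply/measurable_EFinP/cmeasurable_normsq/cmeasurableD.
  - by apply/measurable_EFinP; apply: measurable_funD; apply: measurable_funM => //.
  - by move=> x _; rewrite lee_fin normsqD_le.
rewrite /b; under eq_integral do rewrite EFinD !EFinM.
rewrite ge0_integralD//=.
- rewrite !ge0_integralZl//=; do ?[by apply/measurable_EFinP
    | by move=> x _; rewrite lee_fin normsq_ge0].
  by rewrite lte_add_pinfty// lte_mul_pinfty ?lee_fin.
- by move=> x _; rewrite -EFinM lee_fin mulr_ge0 ?normsq_ge0.
- by apply/measurable_EFinP; apply: measurable_funM.
- by move=> x _; rewrite -EFinM lee_fin mulr_ge0 ?normsq_ge0.
- by apply/measurable_EFinP; apply: measurable_funM.
Qed.

Lemma sqintZ (c : R[i]) f : cmeasurable f ->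
  sqint (fun x => c * f x) = ((normsq c)%:E * sqint f)%E.
Proof.
move=> mf; rewrite /sqint; under eq_integral do rewrite normsqM EFinM.
rewrite ge0_integralZl//=; last by rewrite lee_fin normsq_ge0.
  by apply/measurable_EFinP/cmeasurable_normsq.
by move=> x _; rewrite lee_fin normsq_ge0.
Qed.

Lemma L2Z (c : R[i]) f : L2 mu f -> L2 mu (fun x => c * f x).
Proof.
move=> /L2P[mf fy]; apply/L2P; split.
  by apply: cmeasurableM => //; exact: cmeasurable_cst.
by rewrite sqintZ// lte_mul_pinfty// ?lee_fin ?normsq_ge0.
Qed.

Lemma L2B f g : L2 mu f -> L2 mu g -> L2 mu (fun x => f x - g x).
Proof.
move=> Lf Lg; have := L2D Lf (L2Z (-1) Lg).
by rewrite (_ : (fun _ => _) = (fun x => f x - g x))//; apply/funext => x; rewrite mulN1r.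
Qed.

Lemma L20 : L2 mu (fun=> 0).
Proof.
apply/L2P; split; first exact: cmeasurable_cst.
rewrite /sqint integral0_eq ?ltry// => x _.
by rewrite /normsq /= expr0n addr0.
Qed.

Lemma L2_sum (I : Type) (r : seq I) (P : pred I) (u : I -> T -> R[i]) :
  (forall i, P i -> L2 mu (u i)) -> L2 mu (fun x => \sum_(i <- r | P i) u i x).
Proof.
move=> Lu; elim: r => [|i r IH].
  by under eq_fun do rewrite big_nil; exact: L20.
have [Pi|/negbTE Pi] := boolP (P i); last by under eq_fun do rewrite big_cons Pi.
by under eq_fun do rewrite big_cons Pi; apply: L2D => //; exact: Lu.
Qed.

Lemma integrableZ_EFin (r : R) (h : T -> R) : mu.-integrable setT (EFin \o h) ->
  mu.-integrable setT (EFin \o (fun x => r * h x)).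
Proof.
move=> hi; apply: (eq_integrable measurableT (fun x => r%:E * (EFin \o h) x)%E).
  by [].
exact: integrableZl.
Qed.

Lemma integrableD_EFin (h k : T -> R) : mu.-integrable setT (EFin \o h) ->
  mu.-integrable setT (EFin \o k) ->
  mu.-integrable setT (EFin \o (fun x => h x + k x)).
Proof. by move=> hi ki; exact: (integrableD measurableT hi ki). Qed.

Definition cintegrable f :=
  mu.-integrable setT (EFin \o (fun x => complex.Re (f x))) /\
  mu.-integrable setT (EFin \o (fun x => complex.Im (f x))).

(** Both parts of the product are dominated pointwise by the sum of the squared moduli, which is
    integrable. *)
Lemma L2_mul_integrable f g : L2 mu f -> L2 mu g ->
  cintegrable (fun x => f x * (g x)^*%C).
Proof.
move=> /L2P[mf fy] /L2P[mg gy].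
have [mr mi] := cmeasurableM mf (cmeasurable_conj mg).
have bi : mu.-integrable setT (fun x => (normsq (f x) + normsq (g x))%:E).
  under eq_fun do rewrite EFinD; apply: integrableD => //; apply/integrableP; split.
  - by apply/measurable_EFinP/cmeasurable_normsq.
  - by under eq_integral do rewrite gee0_abs ?lee_fin ?normsq_ge0//.
  - by apply/measurable_EFinP/cmeasurable_normsq.
  - by under eq_integral do rewrite gee0_abs ?lee_fin ?normsq_ge0//.
split; apply: (le_integrable measurableT _ _ bi).
- exact/measurable_EFinP.
- move=> x _; rewrite /= lee_fin [leRHS]ger0_norm ?normsqDge0//.
  by rewrite -(normsq_conj (g x)) Re_mul_le.
- exact/measurable_EFinP.
- move=> x _; rewrite /= lee_fin [leRHS]ger0_norm ?normsqDge0//.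
  by rewrite -(normsq_conj (g x)) Im_mul_le.
Qed.

Lemma cintegralD f g : cintegrable f -> cintegrable g ->
  cintegral mu setT (fun x => f x + g x) = cintegral mu setT f + cintegral mu setT g.
Proof.
move=> [fr fi] [gr gi]; apply/eqP; rewrite eq_complex /=; apply/andP; split; apply/eqP.
  by rewrite -RintegralD//; apply: eq_Rintegral => x _; rewrite raddfD.
by rewrite -RintegralD//; apply: eq_Rintegral => x _; rewrite raddfD.
Qed.

Lemma cintegralZ (c : R[i]) f : cintegrable f ->
  cintegral mu setT (fun x => c * f x) = c * cintegral mu setT f.
Proof.
move=> [fr fi]; case: c => a b; apply/eqP; rewrite eq_complex /=.
apply/andP; split; apply/eqP.
  rewrite -!RintegralZl// -RintegralB; [|by []|exact: integrableZ_EFin|exact: integrableZ_EFin].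
  by apply: eq_Rintegral => x _; case: (f x).
rewrite -!RintegralZl// -RintegralD; [|by []|exact: integrableZ_EFin|exact: integrableZ_EFin].
by apply: eq_Rintegral => x _; case: (f x).
Qed.

Lemma innerDl f g h : L2 mu f -> L2 mu g -> L2 mu h ->
  inner mu (fun x => f x + g x) h = inner mu f h + inner mu g h.
Proof.
move=> Lf Lg Lh; rewrite -cintegralD; [|exact: L2_mul_integrable..].
by congr cintegral; apply/funext => x; rewrite mulrDl.
Qed.

Lemma innerZl c f h : L2 mu f -> L2 mu h ->
  inner mu (fun x => c * f x) h = c * inner mu f h.
Proof.
move=> Lf Lh; rewrite -cintegralZ; last exact: L2_mul_integrable.
by congr cintegral; apply/funext => x; rewrite mulrA.
Qed.

Lemma inner_conj f h : L2 mu f -> L2 mu h -> inner mu h f = (inner mu f h)^*%C.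
Proof.
move=> Lf Lh; have [_ Ii] := L2_mul_integrable Lf Lh.
rewrite /inner /cintegral /=; apply/eqP; rewrite eq_complex /=; apply/andP; split; apply/eqP.
  by apply: eq_Rintegral => x _; rewrite -mulC_conj; case: (_ * _).
rewrite -mulN1r -RintegralZl//; apply: eq_Rintegral => x _.
by rewrite -mulC_conj mulN1r; case: (_ * _).
Qed.

Lemma innerZr c f h : L2 mu f -> L2 mu h ->
  inner mu h (fun x => c * f x) = c^*%C * inner mu h f.
Proof.
move=> Lf Lh.
by rewrite !(inner_conj _ Lh)//; [rewrite innerZl// rmorphM|exact: L2Z].
Qed.

Lemma inner0l h : inner mu (fun=> 0) h = 0.
Proof.
rewrite /inner /cintegral /Rintegral !integral0_eq//= => x _; by rewrite mul0r.
Qed.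

Lemma inner_suml (I : Type) (r : seq I) (P : pred I) (u : I -> T -> R[i]) h :
  (forall i, P i -> L2 mu (u i)) -> L2 mu h ->
  inner mu (fun x => \sum_(i <- r | P i) u i x) h = \sum_(i <- r | P i) inner mu (u i) h.
Proof.
move=> Lu Lh; elim: r => [|i r IH].
  by rewrite big_nil; under eq_fun do rewrite big_nil; exact: inner0l.
rewrite big_cons; have [Pi|/negbTE Pi] := boolP (P i); last first.
  by under eq_fun do rewrite big_cons Pi.
by under eq_fun do rewrite big_cons Pi; rewrite innerDl// ?IH//; [exact: Lu|exact: L2_sum].
Qed.

Lemma inner_sumr (I : Type) (r : seq I) (P : pred I) (u : I -> T -> R[i]) h :
  (forall i, P i -> L2 mu (u i)) -> L2 mu h ->
  inner mu h (fun x => \sum_(i <- r | P i) u i x) = \sum_(i <- r | P i) inner mu h (u i).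
Proof.
move=> Lu Lh; rewrite (inner_conj _ Lh); last exact: L2_sum.
rewrite inner_suml// rmorph_sum; apply: eq_bigr => i Pi.
by rewrite [RHS](inner_conj (Lu i Pi) Lh).
Qed.

Lemma innerBl f g h : L2 mu f -> L2 mu g -> L2 mu h ->
  inner mu (fun x => f x - g x) h = inner mu f h - inner mu g h.
Proof.
move=> Lf Lg Lh; rewrite -[RHS]addr0 -(mulN1r (inner mu g h)) -innerZl// -innerDl ?addr0//.
  by congr inner; apply/funext => x; rewrite mulN1r.
exact: L2Z.
Qed.

Lemma innerBr f g h : L2 mu f -> L2 mu g -> L2 mu h ->
  inner mu h (fun x => f x - g x) = inner mu h f - inner mu h g.
Proof.
move=> Lf Lg Lh.
by rewrite !(inner_conj _ Lh)//; [rewrite innerBl// rmorphB|exact: L2B].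
Qed.

Lemma sqint_inner f : L2 mu f -> sqint f = (complex.Re (inner mu f f))%:E.
Proof.
move=> /L2P[mf fy]; rewrite /inner /= /Rintegral fineK.
  by apply: eq_integral => x _; rewrite mul_conjE.
under eq_integral do rewrite mul_conjE /=.
rewrite ge0_fin_numE//; exact: sqint_ge0.
Qed.

(** The arithmetic-geometric inequality integrated; the free weight [r] plays the part of the
    optimization in Cauchy-Schwarz. *)
Lemma Re_inner_le (r : R) f g : 0 < r -> L2 mu f -> L2 mu g ->
  `|complex.Re (inner mu f g)| <=
    r * complex.Re (inner mu f f) + r^-1 * complex.Re (inner mu g g).
Proof.
move=> r0 Lf Lg; have [Ir _] := L2_mul_integrable Lf Lg.
have [If _] := L2_mul_integrable Lf Lf; have [Ig _] := L2_mul_integrable Lg Lg.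
rewrite /inner /= -!RintegralZl// -RintegralD//; try exact: integrableZ_EFin.
apply: le_trans (le_normr_Rintegral _ _) _ => //.
apply: le_Rintegral => //; first exact: integrable_norm.
  by apply: integrableD_EFin; exact: integrableZ_EFin.
move=> x _; rewrite !mul_conjE /=; case: (f x) (g x) => [a b] [c e]; rewrite /normsq /=.
(* After multiplication by [r] the bound follows from the squares of [r * a - c], [r * a + c] and
   their analogues for [b], [e]. *)
rewrite -(ler_pM2l r0) !mulrDr !mulrA mulfV ?gt_eqF// mul1r.
rewrite -[X in X * `|_|](gtr0_norm r0) -normrM ler_norml.
have := sqr_ge0 (r * a - c); have := sqr_ge0 (r * a + c).
have := sqr_ge0 (r * b - e); have := sqr_ge0 (r * b + e).
by move=> ????; apply/andP; split; nra.
Qed.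

(** Continuity of the inner product in its second argument: [g] is a limit of functions orthogonal
    to [f]. *)
Lemma inner_eq0_approx f g : L2 mu f -> L2 mu g ->
  (forall eps : R, 0 < eps -> exists2 h, L2 mu h /\ inner mu f h = 0 &
     (sqint (fun x => (g x - h x)%R) < eps%:E)%E) -> inner mu f g = 0.
Proof.
move=> Lf Lg ap.
(* Real parts suffice: [c = 1] and [c = 'i] recover both parts of the inner product. *)
have key c : complex.Re (c * inner mu f g) = 0.
  rewrite -innerZl//; set F := fun x => _; have LF : L2 mu F by exact: L2Z.
  apply/eqP; rewrite -normr_eq0 eq_le normr_ge0 andbT.
  have ff0 : 0 <= complex.Re (inner mu F F) by rewrite -lee_fin -sqint_inner ?sqint_ge0.
  apply/ler_addgt0Pl => e e0; rewrite addr0.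
  (* With an approximation of squared error below [r * r], the weighted bound is at most r |F|^2 +
     r, which is [e] for this [r]. *)
  pose r := e / (complex.Re (inner mu F F) + 1).
  have r0 : 0 < r by rewrite divr_gt0// ltr_wpDl.
  have [h [Lh fh]] := ap (r * r) (mulr_gt0 r0 r0).
  have LB := L2B Lg Lh; rewrite sqint_inner// lte_fin => bd.
  have -> : inner mu F g = inner mu F (fun x => g x - h x).
    by rewrite innerBr// [in X in _ - X]/F (@innerZl c)// fh mulr0 subr0.
  apply: le_trans (Re_inner_le r0 LF LB) _.
  have -> : e = r * complex.Re (inner mu F F) + r.
    by rewrite -[X in _ + X]mulr1 -mulrDr /r divfK// gt_eqF// ltr_wpDl.
  rewrite lerD2l -(ler_pM2l r0) mulrA mulfV ?gt_eqF// mul1r.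
  exact: ltW.
have := key 1; have := key 'i%C; rewrite mul1r.
by case: (inner mu f g) => a b /=; rewrite mul0r mul1r sub0r => /eqP; rewrite oppr_eq0 => /eqP-> ->.
Qed.

Lemma inner_null_l f g : L2 mu f -> L2 mu g -> sqint f = 0%E -> inner mu f g = 0.
Proof.
move=> Lf Lg f0; rewrite (inner_conj Lg Lf) (@inner_eq0_approx g f) ?rmorph0//.
move=> e e0; exists (fun=> 0).
  by split; [exact: L20|rewrite (inner_conj L20 Lg) inner0l rmorph0].
by under eq_fun do rewrite subr0; rewrite f0 lte_fin.
Qed.

End L2theory.

(** * Digits and characters *)

Section Digits.
Variable p : nat.
Implicit Types (x y : vilenkin p) (k n : int).
Local Notation q := (Zp_trunc p).+2.

Lemma digit_mulrn x (n : nat) k : (x *+ n) k = x k *+ n.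
Proof. by elim: n => [|n IH]; rewrite ?mulr0n// !mulrS digitD IH. Qed.

Lemma digit_sum (I : Type) (r : seq I) (P : pred I) (u : I -> vilenkin p) k :
  (\sum_(i <- r | P i) u i) k = \sum_(i <- r | P i) u i k.
Proof. exact: (big_morph (fun x : vilenkin p => x k) (fun x y => digitD x y k) (digit0 p k)). Qed.

Lemma digit_gen n k : gen p n k = (k == n)%:R.
Proof. by []. Qed.

Lemma digit_dil n x k : dil n x k = x (k + n).
Proof. by []. Qed.

Lemma Zp_mulrn_id (a : 'Z_p) : (1 : 'Z_p) *+ a = a.
Proof. exact: natr_Zp. Qed.

Lemma Zp_mulrn_char (a : 'Z_p) : a *+ q = 0.
Proof. by apply: val_inj; rewrite Zp_mulrn /= modnMl. Qed.

(** Stated for any injective list of places, so that it serves both the elements of [H0s] and their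
    dilates in [char_window]. *)
Lemma window_sum (n : nat) (f : 'I_n -> int) x : injective f ->
  (forall k, (forall j, k != f j) -> x k = 0) ->
  x = \sum_(j < n) gen p (f j) *+ x (f j).
Proof.
move=> fi xf; apply: vilenkinP => k; rewrite digit_sum.
under eq_bigr do rewrite digit_mulrn digit_gen.
case: (pselect (exists j, k = f j)) => [[j ->]|nj].
  rewrite (bigD1 j)//= eqxx Zp_mulrn_id big1 ?addr0// => i ij.
  by rewrite (inj_eq fi) eq_sym (negbTE ij) mul0rn.
have kf j : k != f j by apply/eqP => kj; apply: nj; exists j.
by rewrite xf// big1// => j _; rewrite (negbTE (kf j)) mul0rn.
Qed.

Lemma H0sP (s : nat) x :
  H0s p s x <-> forall k, (0 <= k) || (k < - s%:Z) -> x k = 0.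
Proof.
split=> [[a _ <-] k ks|xs].
  rewrite digit_sum big1// => j _; rewrite digit_mulrn digit_gen.
  rewrite (_ : (k == _) = false) ?mul0rn//; apply/negP => /eqP kE.
  by have := ltn_ord j; move: ks; rewrite kE; lia.
have fi : injective (fun j : 'I_s => - j.+1%:Z).
  by move=> i j ij; apply/val_inj => /=; lia.
exists [ffun j : 'I_s => x (- j.+1%:Z)] => //; under eq_bigr do rewrite ffunE.
apply/esym/(window_sum fi) => k kj.
apply: xs; case: (leP 0 k) => //= k0; rewrite ltNge; apply/negP => sk.
have ks : (`|k|.-1 < s)%N by lia.
by have /eqP[] := kj (Ordinal ks); rewrite /=; lia.
Qed.

Lemma H0P x : H0 p x <-> forall k, 0 <= k -> x k = 0.
Proof.
split=> [[s _ /H0sP xs] k k0|x0]; first by apply: xs; rewrite k0.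
have /finnegP[m xm] := valP x; exists `|m|%N => //; apply/H0sP => k /orP[/x0//|km].
by apply: xm; rewrite (lt_le_trans km)//; lia.
Qed.

Lemma H0B x y : H0 p x -> H0 p y -> H0 p (x - y).
Proof. by move=> /H0P x0 /H0P y0; apply/H0P => k k0; rewrite digitB x0// y0// subrr. Qed.

Lemma H0D x y : H0 p x -> H0 p y -> H0 p (x + y).
Proof. by move=> /H0P x0 /H0P y0; apply/H0P => k k0; rewrite digitD x0// y0// addr0. Qed.

Lemma dilB n x y : dil n (x - y) = dil n x - dil n y.
Proof. exact: vilenkinP. Qed.

Lemma dil_0 n : dil n (0 : vilenkin p) = 0.
Proof. exact: vilenkinP. Qed.

Lemma dilK n : cancel (@dil p n) (dil (- n)).
Proof. by move=> x; rewrite -dil_add addNr dil0. Qed.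

Lemma dilNK n : cancel (@dil p (- n)) (dil n).
Proof. by move=> x; rewrite -dil_add subrr dil0. Qed.

Lemma dil_gen n k : dil n (gen p k) = gen p (k - n).
Proof.
apply: vilenkinP => j; rewrite digit_dil !digit_gen.
by rewrite -subr_eq opprK.
Qed.

Lemma subGD n x y : subG p n x -> subG p n y -> subG p n (x + y).
Proof. by move=> xn yn k kn; rewrite digitD xn// yn// addr0. Qed.

Lemma subGN n x : subG p n x -> subG p n (- x).
Proof. by move=> xn k kn; rewrite -[- x]add0r digitB xn// subr0. Qed.

Lemma subGB n x y : subG p n x -> subG p n y -> subG p n (x - y).
Proof. by move=> xn yn; apply: subGD => //; exact: subGN. Qed.

Lemma subG_dil n k x : subG p n (dil k x) <-> subG p (n + k) x.
Proof.
split=> xn j jn; last by rewrite digit_dil xn// ltrD2r.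
by rewrite -(subrK k j); apply: xn; rewrite ltrBlDr.
Qed.

Lemma subG_exists x : exists m : nat, subG p (- m%:Z) x.
Proof.
have /finnegP[m xm] := valP x; exists `|m|%N => k km; apply: xm.
by rewrite (lt_le_trans km)//; lia.
Qed.

End Digits.

(** * Roots of unity and the digits of characters *)

Section Roots.
Variables (R : realType) (p : nat).
Local Notation q := (Zp_trunc p).+2.
Implicit Types (a b : 'Z_p) (chi : character R p) (x y : vilenkin p) (n k : int).

Lemma charD chi x y : chi (x + y) = chi x * chi y.
Proof. by case: (characterP chi). Qed.

Lemma char_norm chi x : `|chi x| = 1.
Proof. by case: (characterP chi). Qed.

Lemma char0 chi : chi 0 = 1.
Proof.
by apply: (mulfI (character_neq0 chi 0)); rewrite -charD addr0 mulr1.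
Qed.

Lemma charMn chi x (n : nat) : chi (x *+ n) = chi x ^+ n.
Proof. by elim: n => [|n IH]; rewrite ?mulr0n ?char0// mulrS charD IH exprS. Qed.

Lemma char_sum chi (I : Type) (r : seq I) (P : pred I) (u : I -> vilenkin p) :
  chi (\sum_(i <- r | P i) u i) = \prod_(i <- r | P i) chi (u i).
Proof. exact: (big_morph (pairing chi) (charD chi) (char0 chi)). Qed.

Lemma conj_inv (z : R[i]) : `|z| = 1 -> z^*%C = z^-1.
Proof.
move=> z1; have z0 : z != 0 by rewrite -normr_eq0 z1 oner_eq0.
by apply: (mulfI z0); rewrite mulfV// -sqr_normc z1 expr1n.
Qed.

Lemma char_conj chi x : (chi x)^*%C = chi (- x).
Proof.
rewrite conj_inv ?char_norm//; apply: (mulfI (character_neq0 chi x)).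
by rewrite -charD subrr char0 mulfV ?character_neq0.
Qed.

Lemma charX chi (n : nat) x : (chi ^+ n)%g x = chi x ^+ n.
Proof. by elim: n => [|n IH]; rewrite ?expg0 ?expr0// expgS characterM IH exprS. Qed.

Lemma charMC chi chi' : (chi * chi')%g = (chi' * chi)%g.
Proof. by apply: eq_character => x; rewrite !characterM mulrC. Qed.

Definition zeta a : R[i] := expi (2 * pi * (a : nat)%:R / q%:R).

Lemma radE n x : rad R p n x = zeta (x n).
Proof. by []. Qed.

(** As a value of the character [rad 0], [zeta] inherits the character laws. *)
Lemma zetaE a : zeta a = rad R p 0 (gen p 0 *+ a).
Proof. by rewrite radE digit_mulrn digit_gen eqxx Zp_mulrn_id. Qed.

Lemma zetaD a b : zeta (a + b) = zeta a * zeta b.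
Proof.
by rewrite !zetaE -charD !radE digitD !digit_mulrn !digit_gen eqxx !Zp_mulrn_id.
Qed.

Lemma zeta0 : zeta 0 = 1. Proof. by rewrite zetaE mulr0n char0. Qed.

Lemma zetaMn a (n : nat) : zeta (a *+ n) = zeta a ^+ n.
Proof. by elim: n => [|n IH]; rewrite ?mulr0n ?zeta0// mulrS zetaD IH exprS. Qed.

Lemma zeta_norm a : `|zeta a| = 1. Proof. by rewrite zetaE char_norm. Qed.

Lemma zetaN a : zeta (- a) = (zeta a)^*%C.
Proof.
rewrite conj_inv ?zeta_norm//.
have z0 : zeta a != 0 by rewrite -normr_eq0 zeta_norm oner_eq0.
by apply: (mulfI z0); rewrite mulfV// -zetaD subrr zeta0.
Qed.

Lemma zeta_eq1 a : (zeta a == 1) = (a == 0).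
Proof.
apply/idP/eqP => [|->]; last by rewrite zeta0.
(* [u] is half the angle and lies strictly between 0 and [pi], so cos (2 u) = 1 - 2 (sin u)^2 <
   1. *)
apply: contraTeq => a0; pose u : R := pi * (a : nat)%:R / q%:R.
have an : (0 < (a : nat))%N by rewrite lt0n; apply: contra a0 => /eqP a0; apply/eqP/val_inj.
have u0 : 0 < u by rewrite divr_gt0// mulr_gt0 ?pi_gt0// ltr0n.
have up : u < pi.
  by rewrite /u ltr_pdivrMr// ltr_pM2l ?pi_gt0// ltr_nat; exact: ltn_ord.
have su : 0 < sin u by apply: sin_gt0_pi; rewrite u0 up.
rewrite /zeta (_ : 2 * pi * _ / _ = u + u); last first.
  by rewrite -mulr2n -(mulr_natl u) /u !mulrA.
rewrite /expi eq_complex /= negb_and; apply/orP; left.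
rewrite cosD -!expr2 cos2sin2; apply/eqP.
have := exprn_gt0 2 su; lra.
Qed.

Lemma zetaq a : zeta a ^+ q = 1.
Proof. by rewrite -zetaMn Zp_mulrn_char zeta0. Qed.

(** A geometric sum: multiplied by [zeta a - 1] it telescopes to [zeta a ^+ q - 1 = 0]. *)
Lemma zeta_sum a : \sum_(b : 'Z_p) zeta a ^+ b = (q * (a == 0))%:R.
Proof.
have [->|a0] := eqVneq a 0.
  by rewrite zeta0; under eq_bigr do rewrite expr1n; rewrite sumr_const card_ord muln1.
rewrite muln0; apply/eqP.
have /eqP : (zeta a - 1) * \sum_(b < q) zeta a ^+ b = 0.
  by rewrite -subrX1 zetaq subrr.
by rewrite mulf_eq0 subr_eq0 zeta_eq1 (negbTE a0).
Qed.

Lemma zeta_prim : q.-primitive_root (zeta 1).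
Proof.
apply/andP; split => //; apply/forallP => i; apply/eqP.
rewrite unity_rootE -zetaMn zeta_eq1 -(inj_eq val_inj) /=.
rewrite Zp_nat /=; apply/eqP/eqP => [/eqP|->]; last by rewrite modnn.
by move=> /dvdn_leq qi; apply/eqP; rewrite eqn_leq qi// ltn_ord.
Qed.

Lemma zeta_roots (z : R[i]) : z ^+ q = 1 -> exists a, z = zeta a.
Proof.
move=> /(prim_rootP zeta_prim)[i ->]; exists (1 *+ i).
by rewrite zetaMn.
Qed.

Lemma char_digit_subproof chi k : exists a, chi (gen p k) = zeta a.
Proof.
apply: zeta_roots; rewrite -charMn (_ : gen p k *+ q = 0) ?char0//.
by apply: vilenkinP => j; rewrite digit_mulrn Zp_mulrn_char.
Qed.

(** The exponent of [rad k] in [chi], as [char_digit_radX] confirms; it exists because [gen p k] is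
    annihilated by [q]. *)
Definition char_digit chi k : 'Z_p := projT1 (cid (char_digit_subproof chi k)).

Lemma char_digitE chi k : chi (gen p k) = zeta (char_digit chi k).
Proof. by rewrite /char_digit; case: cid. Qed.

Lemma zeta_inj : injective zeta.
Proof.
move=> a b ab; apply/eqP; rewrite -subr_eq0 -zeta_eq1 zetaD ab -zetaD subrr zeta0//.
Qed.

Lemma char_digitM chi chi' k : char_digit (chi * chi')%g k = char_digit chi k + char_digit chi' k.
Proof. by apply: zeta_inj; rewrite zetaD -!char_digitE characterM. Qed.

Lemma char_digit_radX n (a : 'Z_p) k : char_digit (rad R p n ^+ a)%g k = (k == n)%:R * a.
Proof.
apply: zeta_inj; rewrite -char_digitE charX radE digit_gen eq_sym; case: (k == n).
  by rewrite mul1r -zetaMn Zp_mulrn_id.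
by rewrite mul0r zeta0 expr1n.
Qed.

Lemma char_digit_dil n chi k : char_digit (chi_dil n chi) k = char_digit chi (k - n).
Proof. by apply: zeta_inj; rewrite -!char_digitE /= dil_gen. Qed.

Lemma char_digit_annih n chi k : annih R p n chi -> n <= k -> char_digit chi k = 0.
Proof.
move=> chin nk; apply: zeta_inj; rewrite -char_digitE zeta0 chin// => j jn.
by rewrite digit_gen lt_eqF// (lt_le_trans jn).
Qed.

Lemma annihM n chi chi' : annih R p n chi -> annih R p n chi' -> annih R p n (chi * chi')%g.
Proof. by move=> c c' x xn; rewrite characterM c// c'// mulr1. Qed.

Lemma annih_radX n (a : nat) : annih R p (n + 1) (rad R p n ^+ a)%g.
Proof. by move=> x xn; rewrite charX radE xn ?zeta0 ?expr1n// ltrDl. Qed.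

(* Representatives of [annih (k + s)] modulo [annih k]. *)
Fixpoint char_reps k (s : nat) : seq (character R p) :=
  if s is s'.+1 then
    [seq (chi * rad R p (k + s'%:Z) ^+ a)%g | chi <- char_reps k s', a : 'Z_p <- enum 'Z_p]
  else [:: 1%g].

Lemma char_reps_recr (V : nmodType) (G : character R p -> V) k (s : nat) :
  \sum_(chi <- char_reps k s.+1) G chi =
  \sum_(chi <- char_reps k s) \sum_(a : 'Z_p) G (chi * rad R p (k + s%:Z) ^+ a)%g.
Proof.
rewrite /= big_allpairs_dep; apply: eq_bigr => chi _.
by rewrite big_enum.
Qed.

Lemma char_reps_annih k (s : nat) chi : chi \in char_reps k s -> annih R p (k + s%:Z) chi.
Proof.
elim: s chi => [|s IH] chi; first by rewrite inE => /eqP ->.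
move=> /allpairsP[[c a] /= [/IH cs _ ->]].
rewrite -addn1 PoszD addrA; apply: annihM; last exact: annih_radX.
by apply: annih_le cs; rewrite lerDl.
Qed.

(** Orthogonality of characters on the finite quotient: the sum factors over the places [k], ...,
    [k + s - 1], each factor being a [zeta_sum]. *)
Lemma char_reps_sum k (s : nat) x :
  \sum_(chi <- char_reps k s) chi x = (q ^ s * [forall j : 'I_s, x (k + j%:Z) == 0])%:R.
Proof.
elim: s => [|s IH].
  rewrite big_seq1 (_ : [forall j : 'I_0, _]) ?muln1//.
  by apply/forallP => -[].
rewrite char_reps_recr; under eq_bigr do under eq_bigr do rewrite characterM charX radE.
under eq_bigr do rewrite -mulr_sumr; rewrite -mulr_suml IH zeta_sum -natrM; congr (_%:R).
rewrite mulnACA -expnSr mulnb; congr (_ * _)%N; congr (nat_of_bool _).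
apply/andP/forallP => [[/forallP xs x0] j|xs].
  by case: (ltngtP j s) (ltn_ord j) => [js _|sj|-> _]//;
    [exact: (xs (Ordinal js))|rewrite ltnNge -ltnS ltnNge in sj *; lia].
split; last exact: (xs ord_max).
by apply/forallP => j; exact: (xs (widen_ord (leqnSn s) j)).
Qed.

End Roots.

(** * Haar measures and Fourier coefficients *)

Section ChangeOfVariable.
Context (d : measure_display) (T : measurableType d) (R : realType).
Variables (mu : {measure set T -> \bar R}) (tau : T -> T) (c : {nonneg R}).
Hypothesis mtau : measurable_fun setT tau.
Hypothesis mutau : forall A, measurable A ->
  mu (tau @^-1` A) = (c%:num%:E * mu A)%E.

(** The pushforward of [mu] by [tau] is [mu] scaled by [c]. Translations have [c = 1], and the
    dilation has c = 1/p. *)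
Lemma ge0_integral_comp (h : T -> \bar R) : measurable_fun setT h ->
  (forall x, 0 <= h x)%E ->
  (\int[mu]_x h (tau x) = c%:num%:E * \int[mu]_x h x)%E.
Proof.
move=> mh h0; rewrite -ge0_integral_mscale//.
transitivity (\int[pushforward mu tau]_x h x)%E.
  by rewrite (ge0_integral_pushforward mtau)// preimage_setT.
pose m1 : {measure set T -> \bar R} :=
  measure_function_pushforward__canonical__measure_function_Measure mu mtau.
apply: (@eq_measure_integral _ _ _ _ (mscale c mu) m1) => A mA _.
exact: mutau.
Qed.

Lemma Rintegral_comp (h : T -> R) : mu.-integrable setT (EFin \o h) ->
  Rintegral mu setT (h \o tau) = c%:num * Rintegral mu setT h.
Proof.
move=> hi; rewrite /Rintegral.
have mh := measurable_int _ hi.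
rewrite integralE [in RHS]integralE.
transitivity (fine (c%:num%:E * \int[mu]_x (EFin \o h)^\+ x
                    - c%:num%:E * \int[mu]_x (EFin \o h)^\- x)).
  congr (fine (_ - _)%E).
    rewrite -(ge0_integral_comp (measurable_funepos mh) (funepos_ge0 _)).
    by apply: eq_integral => x _; rewrite !funeposE.
  rewrite -(ge0_integral_comp (measurable_funeneg mh) (funeneg_ge0 _)).
  by apply: eq_integral => x _; rewrite !funenegE.
have fp := integral_funepos_lt_pinfty measurableT hi.
have fn := integral_funeneg_lt_pinfty measurableT hi.
have p0 : (0 <= \int[mu]_x (EFin \o h)^\+ x)%E by apply: integral_ge0.
have n0 : (0 <= \int[mu]_x (EFin \o h)^\- x)%E by apply: integral_ge0.
(* Both integrals are finite, so [fine] respects the difference. *)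
move: (integral mu _ _) (integral mu _ _) fp fn p0 n0 => [a| |] [b| |]//= _ _ _ _.
by rewrite mulrBr.
Qed.

Lemma cmeasurable_comp f : cmeasurable f -> cmeasurable (fun x => f (tau x) : R[i]).
Proof.
move=> [fr fi]; split.
  exact: (measurableT_comp fr mtau).
exact: (measurableT_comp fi mtau).
Qed.

Lemma sqint_comp (f : T -> R[i]) : cmeasurable f ->
  sqint mu (fun x => f (tau x)) = (c%:num%:E * sqint mu f)%E.
Proof.
move=> mf; rewrite -ge0_integral_comp//.
  by apply/measurable_EFinP/cmeasurable_normsq.
by move=> x; rewrite lee_fin normsq_ge0.
Qed.

Lemma L2_comp (f : T -> R[i]) : L2 mu f -> L2 mu (fun x => f (tau x)).
Proof.
move=> /L2P[mf fy]; apply/L2P; split; first exact: cmeasurable_comp.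
by rewrite sqint_comp// lte_mul_pinfty// lee_fin.
Qed.

Lemma inner_comp (f g : T -> R[i]) : L2 mu f -> L2 mu g ->
  inner mu (fun x => f (tau x)) (fun x => g (tau x)) =
  (c%:num)%:C%C * inner mu f g.
Proof.
move=> Lf Lg; have [Ir Ii] := L2_mul_integrable Lf Lg.
have er := Rintegral_comp Ir; have ei := Rintegral_comp Ii.
rewrite /inner /cintegral; apply/eqP; rewrite eq_complex /= !mul0r subr0 addr0.
by rewrite -er -ei !eqxx.
Qed.

End ChangeOfVariable.

(** * Borel sets and cosets *)

Section Borel.
Variable p : nat.
Implicit Types (x y : vilenkin p) (k n : int) (A : set (vilenkin p)).

Lemma open_vilenkinE A : open A = @openG p A.
Proof. by []. Qed.

Lemma open_measurable_vilenkin A : open A -> measurable A.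
Proof. exact: sub_sigma_algebra. Qed.

Lemma continuous_measurable_vilenkin (f : vilenkin p -> vilenkin p) :
  continuous f -> measurable_fun setT f.
Proof.
move=> cf; apply: (measurability (@open (vilenkin p))) => // _ [B oB <-].
by rewrite setTI; apply: open_measurable_vilenkin; exact: open_comp.
Qed.

Lemma locally_cst_open (T : Type) (f : vilenkin p -> T) n (B : set T) :
  (forall x y, subG p n y -> f (x + y) = f x) -> open (f @^-1` B).
Proof. rewrite open_vilenkinE => fn x /= Bfx; by exists n => y yn; rewrite /= fn. Qed.

Lemma locally_cst_measurable d (T : measurableType d) (f : vilenkin p -> T) n :
  (forall x y, subG p n y -> f (x + y) = f x) -> measurable_fun setT f.
Proof.
move=> fn _ B mB; rewrite setTI; apply: open_measurable_vilenkin.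
exact: locally_cst_open fn.
Qed.

Lemma measurable_shift h : measurable_fun setT (fun x => x - h).
Proof.
apply: continuous_measurable_vilenkin => x A /nbhs_subGP[n xA].
by apply/nbhs_subGP; exists n => y yn /=; rewrite addrAC; exact: xA.
Qed.

Lemma measurable_dil n : measurable_fun setT (@dil p n).
Proof. by apply: continuous_measurable_vilenkin; exact: continuous_dil. Qed.

Definition coset y k : set (vilenkin p) := [set x | subG p k (x - y)].

Lemma coset_sub y y' k x : coset y k x -> coset y' k x -> coset y k = coset y' k.
Proof.
move=> xy xy'; have yy' : subG p k (y - y').
  by rewrite (_ : y - y' = (x - y') - (x - y)); [exact: subGB|rewrite opprB [RHS]addrC addrA subrK].
apply/seteqP; split => z zy; rewrite /coset /=.
  by rewrite (_ : z - y' = (z - y) + (y - y')); [exact: subGD|rewrite addrA subrK].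
by rewrite (_ : z - y = (z - y') - (y - y')); [exact: subGB|rewrite opprB addrA subrK].
Qed.

Lemma coset_open y k : open (coset y k).
Proof.
rewrite open_vilenkinE => x xy; exists k => z zk.
by rewrite /coset /= addrAC; exact: subGD.
Qed.

Lemma measurable_coset y k : measurable (coset y k).
Proof. by apply: open_measurable_vilenkin; exact: coset_open. Qed.

Lemma coset0 k : coset 0 k = subG p k.
Proof. by rewrite /coset; apply/seteqP; split => x; rewrite /= subr0. Qed.

Definition cosets : set_system (vilenkin p) :=
  [set A | A = set0 \/ exists y k, A = coset y k].

(** Two cosets are disjoint or nested, so with the empty set they form a pi-system. *)
Lemma cosets_setI : setI_closed cosets.
Proof.
suff main y k y' k' : k <= k' -> cosets (coset y k `&` coset y' k').
  move=> A B [->|[y [k ->]]]; first by rewrite set0I; left.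
  move=> [->|[y' [k' ->]]]; first by rewrite setI0; left.
  by have [kk|/ltW kk] := leP k k'; [exact: main|rewrite setIC; exact: main].
move=> kk; have [->|/set0P[x [xy xy']]] := eqVneq (coset y k `&` coset y' k') set0.
  by left.
right; exists y', k'; apply/setIidr => z zy'.
rewrite (coset_sub xy (_ : coset x k x)); last by rewrite /coset /= subrr.
move: zy'; rewrite (coset_sub xy' (_ : coset x k' x)); last by rewrite /coset /= subrr.
exact: subG_le.
Qed.

(** Finitely supported points coded by a countable type: the list [c.2] gives the digits from place
    [- c.1] upwards. *)
Definition lattice_pt (c : nat * seq 'Z_p) : vilenkin p :=
  \sum_(j < size c.2) gen p (j%:Z - c.1%:Z) *+ nth 0 c.2 j.

Definition lattice_coset (c : nat * seq 'Z_p) :=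
  coset (lattice_pt c) ((size c.2)%:Z - c.1%:Z).

Lemma lattice_cosetP x n : exists c, lattice_coset c = coset x n.
Proof.
(* [m0] makes all digits of [x] below [- m] vanish, and adding [absz n] makes the length [n + m]
   nonnegative. *)
have [m0 xm0] := subG_exists x; pose m := (m0 + absz n)%N.
pose l := absz (n + m%:Z); have lE : l%:Z = n + m%:Z by rewrite /l /m; lia.
pose c := (m, mkseq (fun j => x (j%:Z - m%:Z)) l).
exists c; rewrite /lattice_coset /= size_mkseq lE addrK.
apply: (@coset_sub _ _ _ x); last by rewrite /coset /= subrr.
move=> k kn; rewrite digitB /lattice_pt /= size_mkseq digit_sum.
under eq_bigr => j _ do rewrite digit_mulrn digit_gen nth_mkseq ?ltn_ord//.
have [km|km] := ltP k (- m%:Z).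
  rewrite xm0 ?big1 ?subrr// => [j _|]; last by move: km; rewrite /m; lia.
  by rewrite (_ : (k == _) = false) ?mul0rn//; apply/negP => /eqP; lia.
have jl : (absz (k + m%:Z)%R < l)%N by lia.
have jE : k = (absz (k + m%:Z))%:Z - m%:Z by lia.
rewrite (bigD1 (Ordinal jl))//= -jE eqxx Zp_mulrn_id big1 ?addr0 ?subrr// => i ij.
rewrite (_ : (k == _) = false) ?mul0rn//; apply/negP => /eqP kE.
by move/eqP: ij; apply; apply: val_inj => /=; lia.
Qed.

(** There are countably many cosets, hence every open set is a countable union of the cosets that it
    contains. *)
Lemma measurable_cosets : measurable = <<s cosets >> :> set_system (vilenkin p).
Proof.
apply/seteqP; split; last first.
  apply: smallest_sub; first exact: sigma_algebra_measurable.
  by move=> A [->//|[y [k ->]]]; exact: measurable_coset.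
apply: smallest_sub; first exact: smallest_sigma_algebra.
move=> U; rewrite open_vilenkinE => oU.
(* Runs through all codes, putting the empty set in place of the cosets that are not inside [U]. *)
pose F (i : nat) : set (vilenkin p) := if unpickle i is Some c then
  if `[< lattice_coset c `<=` U >] then lattice_coset c else set0 else set0.
have -> : U = \bigcup_i F i.
  apply/seteqP; split => [x Ux|x [i _]]; last first.
    by rewrite /F; case: unpickle => // c; case: asboolP => // cU /cU.
  have [n xn] := oU x Ux; have [c cE] := lattice_cosetP x n.
  exists (pickle c) => //; rewrite /F pickleK asboolT cE.
    by rewrite /coset /= subrr.
  by move=> z zx; rewrite -(subrK x z) addrC; exact: xn.
apply: sigma_algebra_bigcup => i.
have G0 : <<s cosets >> set0 by apply: sub_sigma_algebra; left.
rewrite /F; case: unpickle => // c; case: asboolP => // _.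
by apply: sub_sigma_algebra; right; do 2 eexists.
Qed.

(** Uniqueness of measures on a generating pi-system, with the subgroups [subG p (- n)] as
    exhaustion by sets of finite measure. *)
Lemma coset_measure_unique (R : realType)
    (m1 m2 : {measure set (vilenkin p) -> \bar R}) :
  (forall y k, m1 (coset y k) = m2 (coset y k)) ->
  (forall n : nat, m1 (subG p (- n%:Z)) < +oo)%E ->
  forall A, measurable A -> m1 A = m2 A.
Proof.
move=> m12 m1oo A mA.
apply: (measure_unique cosets (fun n : nat => subG p (- n%:Z))) => //.
- exact: measurable_cosets.
- exact: cosets_setI.
- by move=> n; right; exists 0, (- n%:Z); rewrite coset0.
- by apply/seteqP; split => // x _; have [n xn] := subG_exists x; exists n.
- by move=> _ [->|[y [k ->]]]; rewrite ?measure0.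
Qed.

End Borel.

(** * Measures with a density *)

Section IntegralMeasure.
Context (d : measure_display) (T : measurableType d) (R : realType).
Variables (mu : {measure set T -> \bar R}) (f : T -> \bar R).
Hypotheses (mf : measurable_fun setT f) (f0 : forall x, (0 <= f x)%E).

(** Measurability and positivity of the density are arguments because the measure structure declared
    below depends on them. *)
Definition integral_measure (_ : measurable_fun setT f)
    (_ : forall x, (0 <= f x)%E) (A : set T) : \bar R := (\int[mu]_(x in A) f x)%E.

Let im0 : integral_measure mf f0 set0 = 0%E.
Proof. exact: integral_set0. Qed.

Let im_ge0 A : (0 <= integral_measure mf f0 A)%E.
Proof. exact: integral_ge0. Qed.

Let im_sigma_additive : semi_sigma_additive (integral_measure mf f0).
Proof.
move=> /= F mF tF mUF; apply: cvg_toP.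
  apply: ereal_nondecreasing_is_cvgn => m n mn.
  by apply: lee_sum_nneg_natr => // k _ _; exact: integral_ge0.
by rewrite /integral_measure ge0_integral_bigcup//; exact: measurable_funTS.
Qed.

HB.instance Definition _ := isMeasure.Build _ _ _
  (integral_measure mf f0) im0 im_ge0 im_sigma_additive.

End IntegralMeasure.

(** * Haar measure under translation and dilation *)

Section Haar.
Variables (R : realType) (p : nat) (mu : {measure set (vilenkin p) -> \bar R}).
Hypotheses (p1 : (1 < p)%N) (hmu : haar_vilenkin mu).
Implicit Types (x y h : vilenkin p) (k n : int) (chi : character R p).
Implicit Types f g : vilenkin p -> R[i].

Lemma haar_shift h A : measurable A ->
  mu ((fun x => x - h) @^-1` A) = ((1%:nng : {nonneg R})%:num%:E * mu A)%E.
Proof.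
move=> mA; rewrite mul1e -(hmu.1 h A mA); congr (mu _).
apply/seteqP; split => [x /= Ax|_ [x Ax <-]] /=; last by rewrite addrAC subrr add0r.
by exists (x - h); rewrite ?subrKC// addrC subrK.
Qed.

Lemma haar_coset y k : mu (coset y k) = (p%:R ^ (- k))%:E.
Proof.
rewrite -hmu.2 -(hmu.1 y (subG p k)); last by rewrite -coset0; exact: measurable_coset.
congr (mu _); apply/seteqP; split => [x xy|_ [x xk <-]].
  by exists (x - y); rewrite // addrC subrK.
by rewrite /coset /= addrAC subrr add0r.
Qed.

Lemma pV_ge0 : 0 <= p%:R^-1 :> R.
Proof. by rewrite invr_ge0. Qed.

(** The preimage of a coset of level [k] is a coset of level [k + 1], of measure [p] times smaller;
    cosets determine the measure. *)
Lemma haar_dil A : measurable A ->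
  mu (dil 1 @^-1` A) = ((NngNum pV_ge0)%:num%:E * mu A)%E.
Proof.
pose m1 : {measure set (vilenkin p) -> \bar R} :=
  measure_function_pushforward__canonical__measure_function_Measure mu
    (@measurable_dil p 1).
pose m2 : {measure set (vilenkin p) -> \bar R} := mscale (NngNum pV_ge0) mu.
have dc y k : dil 1 @^-1` (coset y k) = coset (dil (-1) y) (k + 1).
  apply/seteqP; split => x; rewrite /coset /= => xy.
    by apply/subG_dil; rewrite dilB dilNK.
  by rewrite -[y](dilNK 1) -dilB; apply/subG_dil.
move=> mA; suff : m1 A = m2 A by [].
apply: coset_measure_unique mA => [y k|n].
  rewrite /m1 /m2 /= /pushforward /mscale /= dc !haar_coset -EFinM; congr (_%:E).
  by rewrite opprD expfzDr ?exprN1 1?mulrC// pnatr_eq0; lia.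
rewrite /m1 /= /pushforward -coset0 dc haar_coset ltry//.
Qed.

Definition shiftf h f : vilenkin p -> R[i] := fun x => f (x - h).

Lemma L2_shift h f : L2 mu f -> L2 mu (shiftf h f).
Proof. exact: (L2_comp (@measurable_shift p h) (haar_shift h)). Qed.

Lemma inner_shift h f g : L2 mu f -> L2 mu g ->
  inner mu (shiftf h f) (shiftf h g) = inner mu f g.
Proof.
move=> Lf Lg; rewrite /shiftf (inner_comp (@measurable_shift p h) (haar_shift h))//.
by rewrite mul1r.
Qed.

Lemma shiftf_add h h' f : shiftf h (shiftf h' f) = shiftf (h + h') f.
Proof. by apply/funext => x; rewrite /shiftf opprD addrA. Qed.

Lemma inner_shift2 h h' f g : L2 mu f -> L2 mu g ->
  inner mu (shiftf h f) (shiftf h' g) = inner mu (shiftf (h - h') f) g.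
Proof.
move=> Lf Lg; rewrite -(inner_shift h' (L2_shift (h - h') Lf) Lg) shiftf_add.
by rewrite addrC subrK.
Qed.

Lemma sqint_shift h f : L2 mu f -> sqint mu (shiftf h f) = sqint mu f.
Proof. by move=> Lf; rewrite !sqint_inner ?inner_shift//; exact: L2_shift. Qed.

Definition dilf f : vilenkin p -> R[i] := fun x => f (dil 1 x).

Lemma L2_dilf f : L2 mu f -> L2 mu (dilf f).
Proof. exact: (L2_comp (@measurable_dil p 1) haar_dil). Qed.

Lemma inner_dilf f g : L2 mu f -> L2 mu g ->
  inner mu (dilf f) (dilf g) = p%:R^-1 * inner mu f g.
Proof.
move=> Lf Lg; rewrite /dilf (inner_comp (@measurable_dil p 1) haar_dil)//=.
by rewrite fmorphV /= rmorph_nat.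
Qed.

Lemma locally_cst_L2 f n y k : (forall x z, subG p n z -> f (x + z) = f x) ->
  (forall x, normsq (f x) <= \1_(coset y k) x) -> L2 mu f.
Proof.
move=> fn fb; apply/L2P; split.
  split; apply: (locally_cst_measurable (n := n)) => x z zn; by rewrite fn.
apply: (@le_lt_trans _ _ (\int[mu]_x (\1_(coset y k) x)%:E)%E).
  apply: ge0_le_integral => //.
  - by move=> x _; rewrite lee_fin normsq_ge0.
  - by apply/measurable_EFinP; apply: (locally_cst_measurable (n := n)) => x z zn; rewrite fn.
  - by apply/measurable_EFinP; apply: measurable_indic; exact: measurable_coset.
  - by move=> x _; rewrite lee_fin.
rewrite integral_indic//; last exact: measurable_coset.
by rewrite setIT haar_coset ltry.
Qed.

Definition cind y k x : R[i] := (`[< coset y k x >])%:R.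

Lemma cind_lc y k x z : subG p k z -> cind y k (x + z) = cind y k x.
Proof.
move=> zk; rewrite /cind; congr (_%:R); congr (nat_of_bool _); apply/asboolP/asboolP;
  rewrite /coset /= => xy.
  by rewrite (_ : x - y = x + z - y - z); [exact: subGB|rewrite [RHS]addrAC addrK].
by rewrite addrAC; exact: subGD.
Qed.

Lemma normsq_cind y k x : normsq (cind y k x) = \1_(coset y k) x.
Proof.
rewrite /cind /normsq indicE; case: asboolP => xy.
  by rewrite mem_set//= expr1n expr0n addr0.
by rewrite memNset//= expr0n addr0.
Qed.

Lemma L2_cind y k : L2 mu (cind y k).
Proof.
by apply: (locally_cst_L2 (n := k) (y := y) (k := k)) => [x z|x];
  [exact: cind_lc|rewrite normsq_cind].
Qed.

(* The group of p-th roots of unity has no small subgroups: if all the powers of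
   [chi x] are at distance less than 1 from 1, then their sum over a period has
   positive real part, hence does not vanish, hence [chi x] is 1. *)
Lemma char_lc chi : exists n, annih R p n chi.
Proof.
have [_ _ cc] := characterP chi.
have : nbhs (0 : vilenkin p) [set x | `|1 - chi x| < 1].
  have c0 := cc 0; rewrite /continuous_at char0 in c0.
  exact: (@cvgr_dist_lt (R[i] : numFieldType) ((R[i] : numFieldType)^o) _ _ _ chi 1 c0 1 ltr01).
move=> /nbhs_subGP[n nP]; exists n => x xn.
have Re_gt0 (j : nat) : 0 < complex.Re (chi x ^+ j).
  have xj : subG p n (x *+ j).
    by elim: j => [|j IH]; rewrite ?mulr0n ?mulrS//; exact: subGD.
  have := nP _ xj; rewrite /= add0r charMn; case: (_ ^+ j) => a b.
  rewrite normc_def /= sub0r => ab; have := ab.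
  rewrite -[X in _ < X]/((1 : R)%:C)%C ltcR -[X in _ < X]sqrtr1 ltr_sqrt// sqrrN => ab'.
  have := sqr_ge0 b; nra.
have qx : x *+ (Zp_trunc p).+2 = 0.
  by apply: vilenkinP => j; rewrite digit_mulrn Zp_mulrn_char.
apply/eqP; rewrite -subr_eq0.
have : (chi x - 1) * \sum_(i < (Zp_trunc p).+2) chi x ^+ i = 0.
  by rewrite -subrX1 -charMn qx char0 subrr.
move=> /eqP; rewrite mulf_eq0 => /orP[//|/eqP s0].
have : 0 < complex.Re (\sum_(i < (Zp_trunc p).+2) chi x ^+ i).
  by rewrite raddf_sum /= big_ord_recl ltr_pwDl// ?sumr_ge0// => i _; exact: ltW.
by rewrite s0 ltxx.
Qed.

(* Makes the truncated Fourier integrals inner products: see [cintegral_inner]. *)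
Definition char_on n chi x : R[i] := cind 0 n x * chi x.

Lemma L2_char_on n chi : L2 mu (char_on n chi).
Proof.
have [m chim] := char_lc chi.
apply: (locally_cst_L2 (n := Order.max n m) (y := 0) (k := n)) => [x z zn|x].
  rewrite /char_on cind_lc; last by apply: subG_le zn; rewrite le_max lexx.
  by rewrite charD (chim z) ?mulr1//; apply: subG_le zn; rewrite le_max lexx orbT.
by rewrite /char_on normsqM (normsq1 (char_norm _ _)) mulr1 normsq_cind.
Qed.

Lemma cintegral_inner n f chi :
  cintegral mu (subG p n) (fun x => f x * (chi x)^*%C) = inner mu f (char_on n chi).
Proof.
rewrite /inner /cintegral; congr (_ +i* _)%C; rewrite Rintegral_mkcond;
  apply: eq_Rintegral => x _; rewrite /char_on /cind coset0 patchE; case: asboolP => xn.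
- by rewrite mem_set// mul1r.
- by rewrite memNset// mul0r rmorph0 mulr0.
- by rewrite mem_set// mul1r.
- by rewrite memNset// mul0r rmorph0 mulr0.
Qed.

End Haar.

(** * Square-integrable functions determined by their Fourier coefficients *)

Section Uniqueness.
Variables (R : realType) (p : nat) (mu : {measure set (vilenkin p) -> \bar R}).
Hypotheses (p1 : (1 < p)%N) (hmu : haar_vilenkin mu).
Implicit Types (x y h : vilenkin p) (k n : int) (chi : character R p).
Implicit Types f g : vilenkin p -> R[i].

Lemma pR_neq0 : p%:R != 0 :> R[i].
Proof. by rewrite pnatr_eq0; lia. Qed.

Lemma Zp_trunc_p : (Zp_trunc p).+2 = p. Proof. exact: Zp_cast. Qed.

Lemma Zp_trunc_pR : (Zp_trunc p).+2%:R = p%:R :> R[i].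
Proof. by congr (_%:R); exact: Zp_trunc_p. Qed.

(** Fourier inversion on the finite group G_k / G_(k+s), a rewriting of [char_reps_sum] at
    [x - y]. *)
Lemma cind_reps k (s : nat) y x : subG p k y ->
  cind R y (k + s%:Z) x =
    (p%:R ^+ s)^-1 * \sum_(chi <- char_reps R p k s) (chi y)^*%C * char_on k chi x.
Proof.
move=> yk; under eq_bigr do rewrite /char_on mulrCA char_conj -charD addrC.
rewrite -mulr_sumr char_reps_sum natrM natrX Zp_trunc_pR mulrCA mulKf ?expf_neq0 ?pR_neq0//.
rewrite /cind -natrM mulnb; congr (_%:R); congr (nat_of_bool _).
rewrite /coset /= subr0; apply/asboolP/andP => [xy|[/asboolP xk /forallP xy]].
  split.
    apply/asboolP; rewrite -(subrK y x); apply: subGD => //.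
    by apply: subG_le xy; rewrite lerDl.
  by apply/forallP => j; apply/eqP/xy; rewrite ltrD2l ltz_nat.
move=> j jks; have [jk|kj] := ltP j k; first by rewrite digitB xk// yk// subrr.
have js : (absz (j - k)%R < s)%N by lia.
by have /eqP <- := xy (Ordinal js); congr (digit _ _); rewrite /=; lia.
Qed.

Lemma inner_cind_reps f k (s : nat) y : L2 mu f -> subG p k y ->
  inner mu f (cind R y (k + s%:Z)) =
    (p%:R ^+ s)^-1 * \sum_(chi <- char_reps R p k s) chi y * inner mu f (char_on k chi).
Proof.
move=> Lf yk.
have -> : cind R y (k + s%:Z) = fun x =>
    (p%:R ^+ s)^-1 * \sum_(chi <- char_reps R p k s) (chi y)^*%C * char_on k chi x.
  by apply/funext => x; exact: cind_reps.
have Le chi : L2 mu (fun x => (chi y)^*%C * char_on k chi x) by apply/L2Z/L2_char_on.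
rewrite innerZr//; last by apply: L2_sum.
rewrite fmorphV rmorphXn rmorph_nat inner_sumr//; congr (_ * _).
by apply: eq_bigr => chi _; rewrite innerZr ?conjcK//; exact: L2_char_on.
Qed.

(** A coset is the disjoint union of the cosets of the next level, indexed by the digit at place
    [k]. *)
Lemma cind_split y k x :
  cind R y k x = \sum_(a : 'Z_p) cind R (y + gen p k *+ a) (k + 1) x.
Proof.
rewrite /cind; case: asboolP => [xy|nxy].
  rewrite (bigD1 ((x - y) k))// asboolT ?big1 ?[in RHS]addr0 ?[RHS]addr0// => [a ay|j jk]; last first.
    rewrite opprD addrA [LHS]digitB digit_mulrn digit_gen.
    have [->|jk'] := eqVneq j k; first by rewrite Zp_mulrn_id subrr.
    by rewrite mul0rn subr0 xy//; lia.
  rewrite asboolF// => /(_ k); rewrite opprD addrA digitB digit_mulrn digit_gen eqxx.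
  rewrite Zp_mulrn_id ltrDl => /(_ isT).
  by move/eqP; rewrite subr_eq0 eq_sym (negbTE ay).
rewrite big1// => a _; rewrite asboolF// => xa; apply: nxy => j jk.
have := xa j; rewrite opprD addrA digitB digit_mulrn digit_gen (lt_eqF jk) mul0rn subr0.
by apply; lia.
Qed.

(* The positive and negative parts of [r] are densities of measures that agree on
   cosets, hence everywhere. *)
Lemma integral_coset_eq0 (r : vilenkin p -> R) : measurable_fun setT r ->
  (forall y k, mu.-integrable (coset y k) (EFin \o r)) ->
  (forall y k, Rintegral mu (coset y k) r = 0) ->
  ae_eq mu setT (EFin \o r) (cst 0%E).
Proof.
move=> mr ir r0; have mEr : measurable_fun setT (EFin \o r) by exact/measurable_EFinP.
have mp := measurable_funepos mEr; have mn := measurable_funeneg mEr.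
pose m1 : {measure set (vilenkin p) -> \bar R} :=
  integral_measure mu mp (funepos_ge0 (EFin \o r)).
pose m2 : {measure set (vilenkin p) -> \bar R} :=
  integral_measure mu mn (funeneg_ge0 (EFin \o r)).
have fp y k := integral_funepos_lt_pinfty (measurable_coset y k) (ir y k).
have fn y k := integral_funeneg_lt_pinfty (measurable_coset y k) (ir y k).
have m12 A : measurable A -> m1 A = m2 A.
  apply: coset_measure_unique => [y k|n]; last by rewrite -coset0; exact: fp.
  have := r0 y k; rewrite /Rintegral integralE.
  have p0 := measure_ge0 m1 (coset y k); have n0 := measure_ge0 m2 (coset y k).
  have := fp y k; have := fn y k; move: p0 n0; rewrite /m1 /m2 /= /integral_measure /=.
  move: (integral mu _ _) (integral mu _ _) => [a| |] [b| |]//= _ _ _ _.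
  by move=> /eqP; rewrite subr_eq0 => /eqP ->.
pose A := [set x | 0 <= r x].
have mA : measurable A.
  rewrite (_ : A = setT `&` r @^-1` [set` `[0, +oo[]).
    exact: (mr measurableT _ (measurable_itv _)).
  by rewrite setTI; apply/seteqP; split => x; rewrite /A /= in_itv /= andbT.
have mAC := measurableC mA.
have A0 : m1 A = 0%E.
  rewrite m12//; apply: integral0_eq => x Ax; rewrite funenegE /= -EFin_max.
  by congr (_%:E); rewrite max_r// oppr_le0.
have AC0 : m2 (~` A) = 0%E.
  rewrite -m12//; apply: integral0_eq => x /negP; rewrite -ltNge => Ax.
  by rewrite funeposE /= -EFin_max; congr (_%:E); rewrite max_r// ltW.
apply/ae_eq_integral_abs => //.
rewrite -(setUv A) ge0_integral_setU//; last 2 first.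
  exact/measurable_funTS/measurableT_comp.
  by apply/disj_setPS; rewrite setICr.
rewrite -[RHS]adde0; congr (_ + _)%E.
  rewrite -[RHS]A0; apply: eq_integral => x /set_mem Ax.
  by rewrite funeposE /= -EFin_max; congr (_%:E); rewrite ger0_norm// max_l.
rewrite -[RHS]AC0; apply: eq_integral => x /set_mem /negP; rewrite -ltNge => Ax.
rewrite funenegE /= -EFin_max; congr (_%:E).
by rewrite ltr0_norm// max_l// oppr_ge0 ltW.
Qed.

(** Pairing with [cind R y k] integrates the real and imaginary parts over a coset, so
    [integral_coset_eq0] applies to each. *)
Lemma null_of_cind f : L2 mu f -> (forall y k, inner mu f (cind R y k) = 0) ->
  sqint mu f = 0%E.
Proof.
move=> Lf f0; have [[mr mi] _] := Lf.
have indE (g : R[i] -> R) y k : g 0 = 0 ->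
    (fun x => g (f x * (cind R y k x)^*%C)) = (fun x => g (f x)) \_ (coset y k).
  move=> g0; apply/funext => x; rewrite patchE /cind; case: asboolP => xy.
    by rewrite mem_set// rmorph1 mulr1.
  by rewrite memNset// rmorph0 mulr0.
have iE y k := L2_mul_integrable Lf (L2_cind hmu y k).
have ar : ae_eq mu setT (EFin \o (fun x => complex.Re (f x))) (cst 0%E).
  apply: integral_coset_eq0 => // y k.
    rewrite (integrable_mkcond _ (measurable_coset y k)).
    have [+ _] := iE y k; rewrite (indE (@complex.Re R))//; apply: eq_integrable => // x _.
    by rewrite /= !patchE; case: ifP.
  rewrite Rintegral_mkcond -(indE (@complex.Re R))//.
  by have := f0 y k; rewrite /inner /cintegral => /eqP; rewrite eq_complex => /andP[/eqP].
have ai : ae_eq mu setT (EFin \o (fun x => complex.Im (f x))) (cst 0%E).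
  apply: integral_coset_eq0 => // y k.
    rewrite (integrable_mkcond _ (measurable_coset y k)).
    have [_] := iE y k; rewrite (indE (@complex.Im R))//; apply: eq_integrable => // x _.
    by rewrite /= !patchE; case: ifP.
  rewrite Rintegral_mkcond -(indE (@complex.Im R))//.
  by have := f0 y k; rewrite /inner /cintegral => /eqP; rewrite eq_complex => /andP[_ /eqP].
rewrite -(integral0 mu setT); apply: ge0_ae_eq_integral => //.
- by apply/measurable_EFinP/cmeasurable_normsq.
- by move=> x _; rewrite lee_fin normsq_ge0.
- apply: filterS2 ar ai => x /= /(_ I) [r0] /(_ I) [i0] _.
  by rewrite /normsq r0 i0 expr0n addr0.
Qed.

(** Testing on small cosets suffices: by [cind_split] the larger ones are finite unions of them. *)
Lemma null_of_cind_ge (k0 : int) f : L2 mu f ->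
  (forall y k, k0 <= k -> inner mu f (cind R y k) = 0) -> sqint mu f = 0%E.
Proof.
move=> Lf f0; apply: null_of_cind => // y k.
have main (n : nat) : forall y, inner mu f (cind R y (k0 - n%:Z)) = 0.
  elim: n => [|n IH] z; first by rewrite subr0 f0.
  under [cind _ _ _]funext do rewrite cind_split.
  rewrite inner_sumr//; last by move=> a _; exact: L2_cind.
  by rewrite big1// => a _; rewrite (_ : _ + 1 = k0 - n%:Z) ?IH//; lia.
have [/f0->//|kk0] := leP k0 k.
by rewrite (_ : k = k0 - (absz (k0 - k))%:Z) ?main//; lia.
Qed.

(** Injectivity of the Fourier transform: once [subG p (- m)] contains [y], the indicator of a small
    coset around [y] is a combination of truncated characters. *)
Lemma null_of_char_on (M : nat) f : L2 mu f ->
  (forall (m : nat) chi, (M <= m)%N -> inner mu f (char_on (- m%:Z) chi) = 0) ->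
  sqint mu f = 0%E.
Proof.
move=> Lf f0; apply: (@null_of_cind_ge 0) => // y k k0.
have [m0 ym0] := subG_exists y; pose m := maxn M m0.
have ym : subG p (- m%:Z) y by apply: subG_le ym0; lia.
rewrite (_ : k = - m%:Z + (absz (k + m%:Z))%:Z); last by lia.
rewrite inner_cind_reps// big1 ?mulr0// => chi _.
by rewrite f0 ?mulr0// leq_maxl.
Qed.

End Uniqueness.

Section SumNormsq.
Variable R : realType.

Lemma sqr_sum_le (I : finType) (u : I -> R) :
  (\sum_i u i) ^+ 2 <= #|I|%:R * \sum_i u i ^+ 2.
Proof.
have [I0|I0] := eqVneq #|I| 0%N.
  by rewrite !big1 ?expr0n ?mulr0// => i _; have := card0_eq I0 i; rewrite !inE.
have n0 : 0 < #|I|%:R :> R by rewrite ltr0n lt0n.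
set s := \sum_i u i; pose c := s / #|I|%:R.
(* [c] is the mean, and expanding the variance gives the claim. *)
have : 0 <= \sum_i (u i - c) ^+ 2 by apply: sumr_ge0 => i _; exact: sqr_ge0.
have -> : \sum_i (u i - c) ^+ 2 = \sum_i u i ^+ 2 - s ^+ 2 / #|I|%:R.
  under eq_bigr do rewrite sqrrB; rewrite big_split /= sumrB sumr_const cardT -cardE.
  rewrite sumrMnl -mulr_suml -/s -(mulr_natl (c ^+ 2)) -addrA; congr (_ + _).
  by rewrite /c -mulr_natl; field; rewrite gt_eqF.
by rewrite subr_ge0 ler_pdivrMr// mulrC.
Qed.

Lemma normsq_sum_le (I : finType) (z : I -> R[i]) :
  normsq (\sum_i z i) <= #|I|%:R * \sum_i normsq (z i).
Proof.
rewrite /normsq !raddf_sum /= big_split mulrDr lerD// sqr_sum_le//.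
Qed.

End SumNormsq.

(** * Truncated Fourier transforms on the character group *)

Section FourierSide.
Variables (R : realType) (p N : nat).
Variables (mu : {measure set (vilenkin p) -> \bar R}).
Variables (nu : {measure set (character R p) -> \bar R}).
Hypotheses (p1 : (1 < p)%N) (hmu : haar_vilenkin mu) (hnu : haar_character nu).
Implicit Types (chi xi eta : character R p) (k n : int).

Lemma open_characterE (A : set (character R p)) : open A = @openX R p A.
Proof. by []. Qed.

Lemma open_measurable_character (A : set (character R p)) : open A -> measurable A.
Proof. exact: sub_sigma_algebra. Qed.

Lemma locally_cst_measurableX d (T : measurableType d) (f : character R p -> T) n :
  (forall chi xi, annih R p n xi -> f (chi * xi)%g = f chi) -> measurable_fun setT f.
Proof.
move=> fn _ B mB; rewrite setTI; apply: open_measurable_character.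
by rewrite open_characterE => chi /= Bf; exists n => xi xin; rewrite /= fn.
Qed.

Lemma measurable_mul eta : measurable_fun setT (fun chi : character R p => (chi * eta)%g).
Proof.
apply: (measurability (@open (character R p))) => // _ [B oB <-].
rewrite setTI; apply: open_measurable_character; rewrite open_characterE => chi /= Bc.
have [n nB] := oB _ Bc; exists n => xi xin /=.
by rewrite -mulgA (charMC xi) mulgA; exact: nB.
Qed.

Lemma haar_mul eta (A : set (character R p)) : measurable A ->
  nu ((fun chi => (chi * eta)%g) @^-1` A) = ((1%:nng : {nonneg R})%:num%:E * nu A)%E.
Proof.
move=> mA; rewrite mul1e -(hnu.1 (eta^-1)%g A mA); congr (nu _).
apply/seteqP; split => [x /= Ax|_ [x Ax <-]] /=; last by rewrite charMC mulVKg.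
by exists (x * eta)%g; rewrite // charMC mulgK.
Qed.

Lemma measurable_annih n : measurable (annih R p n).
Proof.
apply: open_measurable_character; rewrite open_characterE => chi chin.
by exists n => xi xin; exact: annihM.
Qed.

Variables (phi : vilenkin p -> R[i]) (F : character R p -> R[i]).
Hypothesis Lphi : L2 mu phi.

Definition fcoef (n : nat) chi : R[i] := inner mu phi (char_on (- n%:Z) chi).

Lemma fcoef_annih (n : nat) chi xi : annih R p (- n%:Z) xi ->
  fcoef n (chi * xi)%g = fcoef n chi.
Proof.
move=> xin; congr inner; apply/funext => x; rewrite /char_on /cind coset0.
by case: asboolP => xn; rewrite ?mul0r// characterM xin ?mulr1.
Qed.

(** G_(-n) is cut out of G_(-n-1) by the vanishing of the digit at [- n.+1], and averaging over the
    powers of [rad R p (- n.+1)] detects this vanishing. *)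
Lemma fcoef_step (n : nat) chi : fcoef n chi =
  p%:R^-1 * \sum_(a : 'Z_p) fcoef n.+1 (chi * rad R p (- n.+1%:Z) ^+ a)%g.
Proof.
have -> : fcoef n chi = inner mu phi (fun x => p%:R^-1 * \sum_(a : 'Z_p)
    char_on (- n.+1%:Z) (chi * rad R p (- n.+1%:Z) ^+ a)%g x).
  congr inner; apply/funext => x; rewrite /char_on.
  under eq_bigr do rewrite characterM charX radE mulrA.
  rewrite -mulr_sumr zeta_sum natrM Zp_trunc_pR//.
  transitivity (cind R 0 (- n.+1%:Z) x * (x (- n.+1%:Z) == 0)%:R * chi x); last first.
    by field; exact: pR_neq0.
  congr (_ * _); rewrite /cind !coset0 -natrM mulnb.
  congr (_%:R); congr (nat_of_bool _); apply/asboolP/andP => [xn|[/asboolP xn /eqP x0] k kn].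
    split; last by apply/eqP/xn; lia.
    by apply/asboolP; apply: subG_le xn; lia.
  by have [->//|kn'] := eqVneq k (- n.+1%:Z); apply: xn; lia.
rewrite innerZr//; last by apply: L2_sum => a _; exact: L2_char_on.
rewrite fmorphV rmorph_nat inner_sumr// => a _; exact: L2_char_on.
Qed.

Hypothesis FN : forall chi xi, annih R p (- N%:Z) xi -> F (chi * xi)%g = F chi.

Definition fdiff (n : nat) chi := F chi - fcoef n chi.

Lemma fdiff_annih (n : nat) chi xi : (N <= n)%N -> annih R p (- n%:Z) xi ->
  fdiff n (chi * xi)%g = fdiff n chi.
Proof.
move=> Nn xin; rewrite /fdiff fcoef_annih// FN//.
by apply: annih_le xin; lia.
Qed.

(** [F] equals its own average, since for [N <= n] the powers of [rad R p (- n.+1)] lie in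
    [annih R p (- N)]. *)
Lemma fdiff_step (n : nat) chi : (N <= n)%N -> fdiff n chi =
  p%:R^-1 * \sum_(a : 'Z_p) fdiff n.+1 (chi * rad R p (- n.+1%:Z) ^+ a)%g.
Proof.
move=> Nn; rewrite /fdiff sumrB mulrBr -fcoef_step; congr (_ - _).
rewrite (eq_bigr (fun=> F chi)) => [|a _]; last first.
  by apply: FN; apply: annih_le (@annih_radX R p (- n.+1%:Z) a); lia.
rewrite sumr_const card_ord -(mulr_natl (F chi)) Zp_trunc_pR// mulKf ?pR_neq0//.
Qed.

Lemma cmeasurable_fdiff (n : nat) : (N <= n)%N -> cmeasurable (fdiff n).
Proof.
move=> Nn; split; apply: (locally_cst_measurableX (n := - n%:Z)) => chi xi xin;
  by rewrite fdiff_annih.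
Qed.

(** The squared modulus of an average is at most the average of the squared moduli, and by
    invariance of [nu] each translate has the same integral. *)
Lemma sqint_fdiff_step (n : nat) : (N <= n)%N ->
  (sqint nu (fdiff n) <= sqint nu (fdiff n.+1))%E.
Proof.
move=> Nn; have mD := cmeasurable_fdiff (leqW Nn).
have p0 : 0 < p%:R :> R by rewrite ltr0n; lia.
pose t (a : 'Z_p) chi := fdiff n.+1 (chi * rad R p (- n.+1%:Z) ^+ a)%g.
have mt a : cmeasurable (t a).
  exact: (cmeasurable_comp (@measurable_mul (rad R p (- n.+1%:Z) ^+ a)%g)).
have mnt a : measurable_fun setT (fun chi => (normsq (t a chi))%:E).
  exact/measurable_EFinP/cmeasurable_normsq.
apply: (@le_trans _ _ (\int[nu]_chi (p%:R^-1%:E * \sum_(a : 'Z_p) (normsq (t a chi))%:E))%E).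
  apply: ge0_le_integral => //.
  - by move=> chi _; rewrite lee_fin normsq_ge0.
  - by apply/measurable_EFinP/cmeasurable_normsq/cmeasurable_fdiff.
  - by apply: measurable_funeM; exact: emeasurable_sum.
  - move=> chi _; rewrite sumEFin -EFinM lee_fin fdiff_step// normsqM.
    have -> : normsq (p%:R^-1 : R[i]) = (p%:R^-1) ^+ 2.
      apply: (@complexI R); rewrite normsqE normfV ger0_norm ?ler0n//.
      by rewrite rmorphXn fmorphV /= rmorph_nat.
    rewrite expr2 -mulrA ler_wpM2l ?invr_ge0// ler_pdivrMl//.
    apply: le_trans (normsq_sum_le _) _.
    by rewrite card_ord (_ : _.+2%:R = p%:R)//; congr (_%:R); exact: Zp_cast.
rewrite ge0_integralZl//=; last 2 first.
- by apply: emeasurable_sum.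
- by move=> chi _; apply: sume_ge0 => a _; rewrite lee_fin normsq_ge0.
rewrite ge0_integral_sum//; last by move=> a chi _; rewrite lee_fin normsq_ge0.
rewrite (eq_bigr (fun=> sqint nu (fdiff n.+1))) => [|a _]; last first.
  rewrite -/(sqint nu (t a)).
  rewrite (sqint_comp (@measurable_mul (rad R p (- n.+1%:Z) ^+ a)%g) (haar_mul _))//.
  by rewrite mul1e.
case: (sqint nu (fdiff n.+1)) (sqint_ge0 nu (fdiff n.+1)) => [r| |]// _; rewrite ?leey//.
rewrite sumEFin sumr_const card_ord -EFinM lee_fin -(mulr_natl r).
rewrite (_ : _.+2%:R = p%:R); last by congr (_%:R); exact: Zp_cast.
by rewrite mulKf// gt_eqF.
Qed.

Lemma sqint_fdiff_mono (m n : nat) : (N <= m)%N -> (m <= n)%N ->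
  (sqint nu (fdiff m) <= sqint nu (fdiff n))%E.
Proof.
move=> Nm; elim: n => [|n IH]; first by rewrite leqn0 => /eqP ->.
rewrite leq_eqVlt => /orP[/eqP -> //|mn].
by apply: le_trans (IH mn) _; apply: sqint_fdiff_step; exact: leq_trans Nm _.
Qed.

(** [fdiff m] is constant on the coset of [annih R p (- m)] through [chi], so that coset alone
    contributes the left-hand side. *)
Lemma sqint_fdiff_ge (m : nat) chi : (N <= m)%N ->
  ((normsq (fdiff m chi) * p%:R ^ (- m%:Z))%:E <= sqint nu (fdiff m))%E.
Proof.
move=> Nm; pose C := [set (chi * xi)%g | xi in annih R p (- m%:Z)].
have CE : C = (fun xi => (xi * chi^-1)%g) @^-1` (annih R p (- m%:Z)).
  apply/seteqP; split => [_ [xi xim <-]|xi xim] /=; first by rewrite charMC mulKg.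
  by exists (xi * chi^-1)%g; rewrite // charMC mulgVK.
have mC : measurable C.
  rewrite CE -[X in measurable X]setTI; apply: measurable_mul => //.
  exact: measurable_annih.
have nC : nu C = (p%:R ^ (- m%:Z))%:E.
  by rewrite hnu.1 ?hnu.2//; exact: measurable_annih.
rewrite EFinM -nC -[X in nu X]setIT -integral_indic//.
rewrite -ge0_integralZl//=; last 2 first.
- by apply/measurable_EFinP/measurable_indic.
- by rewrite lee_fin normsq_ge0.
apply: ge0_le_integral => //.
- by move=> x _; rewrite -EFinM lee_fin mulr_ge0// normsq_ge0.
- by apply/measurable_EFinP; apply: measurable_funM => //; exact: measurable_indic.
- by apply/measurable_EFinP/cmeasurable_normsq/cmeasurable_fdiff.
move=> x _; rewrite -EFinM lee_fin indicE; case: (boolP (x \in C)) => [/set_mem[xi xim <-]|_].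
  by rewrite fdiff_annih// mulr1.
by rewrite mulr0 normsq_ge0.
Qed.

(* The L_2-distances between F and its approximations increase with n, because
   each approximation is an average of translates of the next one, and they tend
   to 0: so they vanish. *)
Lemma fourier_exact : is_fourier mu nu phi F ->
  forall (m : nat) chi, (N <= m)%N -> inner mu phi (char_on (- m%:Z) chi) = F chi.
Proof.
move=> [_ _ cF] m chi Nm; apply/eqP; rewrite eq_sym -subr_eq0 -normsq_eq0.
(* A nonzero difference at [chi] keeps all later squared distances at or above the positive number
   [e]. *)
apply/negPn/negP => d0; pose e := normsq (fdiff m chi) * p%:R ^ (- m%:Z).
have p0 : 0 < p%:R :> R by rewrite ltr0n; lia.
have e0 : 0 < e by rewrite mulr_gt0 ?exprz_gt0// lt0r d0 normsq_ge0.
have se0 : 0 < Num.sqrt e by rewrite sqrtr_gt0.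
have {}cF : (fun n : nat => L2norm nu (fdiff n)) @ \oo --> 0%E.
  move: cF; rewrite (_ : (fun n : nat => _) = fun n : nat => L2norm nu (fdiff n))//.
  apply/funext => n; congr L2norm; apply/funext => xi.
  by rewrite cintegral_inner.
have : \forall n \near \oo, (L2norm nu (fdiff n) < (Num.sqrt e)%:E)%E.
  apply: (cF [set x | (x < (Num.sqrt e)%:E)%E]); apply: open_nbhs_nbhs.
  by split; [exact: open_ereal_lt_ereal|rewrite /= lte_fin].
move=> [n0 _ n0P]; have := n0P (maxn n0 m) (leq_maxl _ _).
rewrite /= L2norm_lt// sqr_sqrtr ?ltW// ltNge => /negP; apply.
by apply: le_trans (sqint_fdiff_ge chi Nm) _; apply: sqint_fdiff_mono; rewrite ?leq_maxr.
Qed.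

End FourierSide.

(** * The tree and the mask *)

Section Tree.
Variables (V : Type) (t : ltree V).
Local Notation root := (troot t).
Local Notation edge := (@tedge V t).

Definition rpath (v : tvertex t) := projT1 (cid (ltreeP v)).

Lemma rpathP v : path edge root (rpath v) /\ last root (rpath v) = v.
Proof. by rewrite /rpath; case: cid => s []. Qed.

Lemma rpath_uniq v s : path edge root s -> last root s = v -> rpath v = s.
Proof. by move=> ps ls; rewrite /rpath; case: cid => r /= [_ /(_ s)]; apply. Qed.

Definition vlevel v := size (rpath v).

Lemma rpath_edge u v : edge u v -> rpath v = rcons (rpath u) v.
Proof.
move=> uv; have [pu lu] := rpathP u.
by apply: rpath_uniq; rewrite ?last_rcons// rcons_path pu lu.
Qed.

Lemma vlevel_edge u v : edge u v -> vlevel v = (vlevel u).+1.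
Proof. by move=> /rpath_edge uv; rewrite /vlevel uv size_rcons. Qed.

Lemma vlevel_root : vlevel root = 0%N.
Proof. by rewrite /vlevel (@rpath_uniq _ [::]). Qed.

Lemma vlevel_eq0 v : vlevel v = 0%N -> v = root.
Proof. by move=> /size0nil v0; have [_ <-] := rpathP v; rewrite v0. Qed.

Lemma edge_root u : ~~ edge u root.
Proof. by apply/negP => /vlevel_edge; rewrite vlevel_root. Qed.

(** The parent is the end of the path from the root to [v] with its last vertex removed. *)
Lemma edge_inj u u' v : edge u v -> edge u' v -> u = u'.
Proof.
move=> /rpath_edge uv /rpath_edge; rewrite uv => /rcons_inj[uu' ].
by have [_ <-] := rpathP u; have [_ <-] := rpathP u'; rewrite uu'.
Qed.

Lemma edge_parent v : v != root -> exists u, edge u v.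
Proof.
move=> vr; have [] := rpathP v.
case/lastP: (rpath v) => [_ /= rv|s x]; first by rewrite rv eqxx in vr.
by rewrite rcons_path last_rcons => /andP[_ ex] <-; exists (last root s).
Qed.

End Tree.

Section Window.
Variable p : nat.

(** The digits are read downwards from place [k], which is the order of the labels along the paths
    of the tree. *)
Definition window (n : nat) (d : int -> 'Z_p) (k : int) : n.-tuple 'Z_p :=
  [tuple d (k - j%:Z) | j < n].

Lemma window_cons n d k : window n.+1 d k = cons_tuple (d k) (window n d (k - 1)).
Proof.
apply: eq_from_tnth => j; rewrite tnth_mktuple; case: (unliftP ord0 j) => [i ->|->].
  by rewrite tnthS tnth_mktuple lift0; congr d; lia.
by rewrite tnth0 subr0.
Qed.

Lemma window_zero (n : nat) d k : (forall j, k - n%:Z < j -> j <= k -> d j = 0) ->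
  window n d k = [tuple of nseq n 0].
Proof.
move=> d0; apply: eq_from_tnth => j; rewrite tnth_mktuple.
rewrite (tnth_nth 0) nth_nseq ltn_ord; apply: d0; have := ltn_ord j; lia.
Qed.

Lemma window_zero_inv (n : nat) d k : window n d k = [tuple of nseq n 0] ->
  forall j, k - n%:Z < j -> j <= k -> d j = 0.
Proof.
move=> wz j kj jk; have jn : (absz (k - j)%R < n)%N by lia.
have := congr1 (fun w => tnth w (Ordinal jn)) wz.
rewrite tnth_mktuple (tnth_nth 0) nth_nseq jn => <-; congr d => /=; lia.
Qed.

End Window.

Section ValidTree.
Variables (p N : nat) (t : ltree 'Z_p).
Hypotheses (N0 : (0 < N)%N) (vt : valid_tree N t).
Local Notation root := (troot t).
Local Notation edge := (@tedge _ t).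
Local Notation label := (@tlabel _ t).
Implicit Types (b : N.-tuple 'Z_p).

Let vt_path b : exists! w, tree_path (t := t) b w.
Proof. by case: vt => _ _; apply. Qed.

Definition lpath b := projT1 (cid (vt_path b)).

Lemma lpathP b : tree_path (t := t) b (lpath b).
Proof. by rewrite /lpath; case: cid => w []. Qed.

Lemma lpath_uniq b w : tree_path (t := t) b w -> lpath b = w.
Proof. by rewrite /lpath; case: cid => r /= [_ /(_ w)]; apply. Qed.

Lemma size_lpath b : size (lpath b) = N.
Proof. by have [_] := lpathP b => /(congr1 size); rewrite size_map size_tuple. Qed.

Definition lhead b := head root (lpath b).

Lemma lpath_cons b : lpath b = lhead b :: behead (lpath b).
Proof.
rewrite /lhead; have := size_lpath b; case: (lpath b) => //= eN.
by move: N0; rewrite -eN.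
Qed.

(** The prefix of length [i] witnesses that the vertex has level [i], below [N]. *)
Lemma label_root_path s (i : nat) : path edge root s -> (i < N)%N -> (i <= size s)%N ->
  label (nth root (root :: s) i) = 0.
Proof.
move=> ps iN si; have [lab _ _] := vt; apply: (lab _ i) => //.
exists (take i s); split; last by rewrite size_takel.
  exact: take_path.
by rewrite -nth_last /= size_takel//; case: i iN si => [|i] iN si /=;
  rewrite ?take0//= nth_take.
Qed.

Lemma lhead_zero b : lhead b = root -> b = [tuple of nseq N 0].
Proof.
move=> hr; apply: val_inj => /=; have [st <-] := lpathP b.
apply: (@eq_from_nth _ 0); rewrite size_map size_lpath ?size_nseq// => i iN.
rewrite (nth_map root) ?size_lpath// nth_nseq iN lpath_cons hr.
move: st; rewrite lpath_cons hr /= => pr; apply: label_root_path => //.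
by have := size_lpath b; rewrite lpath_cons /=; lia.
Qed.

(** Prolong the path labelled by zeros upwards to the root. The first [N] vertices of the result are
    also labelled by zeros, so by uniqueness they are the given path, which therefore starts at the
    root. *)
Lemma lhead_nseq : lhead [tuple of nseq N 0] = root.
Proof.
set z := [tuple of _]; have [st lz] := lpathP z.
have [pr lr] := rpathP (lhead z).
set s := rpath _ in pr lr; pose w := root :: s ++ behead (lpath z).
have pw : path edge root (s ++ behead (lpath z)).
  by rewrite cat_path pr lr; move: st; rewrite lpath_cons.
have sw : (N <= size w)%N by have := size_lpath z; rewrite lpath_cons /w /= size_cat; lia.
have : lpath z = take N w.
  apply: lpath_uniq; split; first by have : sorted edge w by []; exact: take_sorted.
  apply: (@eq_from_nth _ 0); rewrite size_map size_takel// ?size_tuple// => i iN.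
  rewrite (nth_map root) ?size_takel// nth_take// nth_nseq iN.
  by apply: label_root_path => //; move: sw; rewrite /w /=; lia.
by rewrite /lhead => ->; case: N N0.
Qed.

(** Edges point away from the root, so prepending a label to a word adds the parent of the head of
    its path; the tail is forced by uniqueness. *)
Lemma tree_path_cons c b w : tree_path (t := t) (c :: b) w ->
  exists2 u, edge u (lhead b) & label u = c /\ w = u :: lpath b.
Proof.
case: w => [[_]//|u w] [/= st [lu lw]].
have wE : lpath b = w by apply: lpath_uniq; split => //; exact: path_sorted st.
exists u; last by rewrite wE.
by move: st; rewrite -wE lpath_cons /= => /andP[].
Qed.

Variable R : realType.
Variable lam : N.+1.-tuple 'Z_p -> R[i].
Hypothesis lamP : mask_values t lam.

Lemma cons_zeroE (c : 'Z_p) b : (cons_tuple c b == [tuple of nseq N.+1 0]) =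
  (c == 0) && (b == [tuple of nseq N 0]).
Proof. by rewrite -(inj_eq val_inj) /= eqseq_cons. Qed.

(* The admissible [c] is the label of the parent of the head of [lpath b], or 0
   when the head is the root. *)
Lemma lam_ex b : exists c0, forall c, `|lam (cons_tuple c b)| = (c == c0)%:R.
Proof.
have [lam0 lam1] := lamP; have [hr|hr] := eqVneq (lhead b) root.
  exists 0 => c; have bz := lhead_zero hr; have [->|c0] := eqVneq c 0.
    by rewrite (_ : cons_tuple _ _ = [tuple of nseq N.+1 0]) ?lam0 ?normr1//;
      apply/eqP; rewrite cons_zeroE eqxx bz eqxx.
  have [|_ ->] := lam1 (cons_tuple c b); rewrite ?normr0 ?cons_zeroE ?(negbTE c0)//.
  by move=> [w /tree_path_cons[u]]; rewrite hr (negbTE (edge_root _)).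
have [u uh] := edge_parent hr; exists (label u) => c.
have bz : b != [tuple of nseq N 0] by apply: contraNneq hr => ->; rewrite lhead_nseq.
have nz : cons_tuple c b != [tuple of nseq N.+1 0] by rewrite cons_zeroE (negbTE bz) andbF.
have [l1 l0] := lam1 _ nz; have [cu|cu] := eqVneq c (label u).
  rewrite l1//; exists (u :: lpath b); have [st lb] := lpathP b.
  by split; [move: st; rewrite lpath_cons /= uh|rewrite /= lb cu].
rewrite l0 ?normr0// => -[w /tree_path_cons[u' u'h [lu' _]]].
by move/eqP: cu; apply; rewrite -lu' (edge_inj uh u'h).
Qed.

(* Shifting the window up moves the head of the labelled path to its parent. *)
Lemma window_step d k : lam (window N.+1 d k) != 0 ->
  vlevel (lhead (window N d k)) = (vlevel (lhead (window N d (k - 1)))).-1.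
Proof.
move=> lnz; have [wz|wz] := eqVneq (window N.+1 d k) [tuple of nseq N.+1 0].
  have d0 := window_zero_inv wz.
  (* Both heads are the root, and the truncated predecessor keeps level 0 at 0. *)
  rewrite !window_zero ?lhead_nseq ?vlevel_root// => j kj jk; apply: d0; lia.
have [_ l0] := lamP.2 _ wz.
have [w] : exists w, tree_path (t := t) (window N.+1 d k) w.
  by apply/not_existsP => nw; move/eqP: lnz; apply; apply: l0 => -[w]; exact: nw.
move=> tw; have := tw; rewrite window_cons => /tree_path_cons[u uh [lu wE]].
rewrite (vlevel_edge uh) /=; congr (vlevel _); rewrite /lhead.
(* The path [w] of [N.+1] vertices begins with the path of the upper window, whose head is thus
   [u]. *)
suff -> : lpath (window N d k) = take N w by rewrite wE -[X in take X](prednK N0).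
have [sw lw] := tw; apply: lpath_uniq; split; first exact: take_sorted.
rewrite map_take lw; apply: (@eq_from_nth _ 0); rewrite size_takel ?size_tuple// => i iN.
rewrite nth_take//; have iN1 : (i < N.+1)%N by exact: ltnW.
have := tnth_nth 0 (window N.+1 d k) (Ordinal iN1); rewrite tnth_mktuple => <-.
by have := tnth_nth 0 (window N d k) (Ordinal iN); rewrite tnth_mktuple => <-.
Qed.

(** The number of consecutive nonzero factors after which the walk towards the root must have
    ended. *)
Definition depth := (\max_(b : N.-tuple 'Z_p) vlevel (lhead b))%N.

(** Each nonzero factor lowers the level of the head by one, so after [s >= depth] of them the head
    is the root, whose word is zero. *)
Lemma depth_zero d (s : nat) : (depth <= s)%N ->
  (forall n : nat, (n < s)%N -> lam (window N.+1 d n%:Z) != 0) ->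
  forall j, s%:Z - N%:Z <= j -> j < s%:Z -> d j = 0.
Proof.
move=> Ds dn j sj js; have H (n : nat) : (n <= s)%N ->
    vlevel (lhead (window N d (n%:Z - 1))) = (vlevel (lhead (window N d (-1))) - n)%N.
  elim: n => [|n IH] ns; first by rewrite sub0r subn0.
  have -> : n.+1%:Z - 1 = n%:Z by lia.
  by rewrite (window_step (dn _ ns)) IH ?subnS// ltnW.
have := H s (leqnn s).
have -> : (vlevel (lhead (window N d (-1))) - s = 0)%N.
  apply/eqP; rewrite subn_eq0; apply: leq_trans Ds.
  exact: (leq_bigmax (window N d (-1))).
move=> /vlevel_eq0/lhead_zero/window_zero_inv; apply; lia.
Qed.

End ValidTree.

(** * The mask in terms of digits, and its infinite product *)

Section Mask.
Variables (R : realType) (p N : nat) (t : ltree 'Z_p).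
Variables (lam : N.+1.-tuple 'Z_p -> R[i]) (m0 : character R p -> R[i]).
Variable beta : vilenkin p -> R[i].
Hypothesis lamP : mask_values t lam.
Hypotheses (m0P : is_mask lam m0) (betaP : mask_coefs N m0 beta).
Implicit Types (chi xi : character R p) (k : int) (x h : vilenkin p).

Definition H0seq : seq (vilenkin p) := finmap.enum_fset (fset_set (H0s p N.+1)).

Lemma mem_H0seq h : (h \in H0seq) = (h \in H0s p N.+1).
Proof. by rewrite /H0seq in_fset_set//; exact: finite_H0s. Qed.

Lemma H0seqP h : h \in H0seq -> forall k, (0 <= k) || (k < - N.+1%:Z) -> h k = 0.
Proof. by rewrite mem_H0seq => /set_mem /H0sP. Qed.

Lemma sum_H0seq (G : vilenkin p -> R[i]) :
  \sum_(h \in H0s p N.+1) G h = \sum_(h <- H0seq) G h.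
Proof. by rewrite fsbig_finite//; exact: finite_H0s. Qed.

Lemma char_window chi (n : nat) (f : 'I_n -> int) x : injective f ->
  (forall k, (forall j, k != f j) -> x k = 0) ->
  chi x = \prod_(j < n) zeta R (char_digit chi (f j)) ^+ x (f j).
Proof.
move=> fi xf; rewrite {1}(window_sum fi xf) char_sum.
by apply: eq_bigr => j _; rewrite charMn char_digitE.
Qed.

(** In the expansion with [beta] the character is evaluated only at points [dil (-1) h], whose
    digits live at the places [- N], ..., 0. *)
Lemma m0_digits chi xi :
  (forall j : nat, (j <= N)%N -> char_digit chi (- j%:Z) = char_digit xi (- j%:Z)) ->
  m0 chi = m0 xi.
Proof.
move=> cx; rewrite !betaP !sum_H0seq; congr (_ * _); apply: eq_big_seq => h hH.
congr (_ * _^*%C); rewrite /=.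
have fi : injective (fun j : 'I_N.+1 => - j%:Z).
  by move=> i j /oppr_inj [ij]; exact: val_inj.
have xf k : (forall j : 'I_N.+1, k != - j%:Z) -> dil (-1) h k = 0.
  move=> kj; rewrite digit_dil (H0seqP hH)//; apply/negPn; rewrite negb_or -ltNge -leNgt.
  apply/negP => /andP[k0 kN]; have kN' : (absz k < N.+1)%N by lia.
  by have := kj (Ordinal kN'); rewrite /=; lia.
rewrite !(char_window _ fi xf); apply: eq_bigr => j _.
by rewrite cx// -ltnS ltn_ord.
Qed.

Lemma char_digit_prod (I : Type) (r : seq I) (P : pred I) (u : I -> character R p) k :
  char_digit (\prod_(i <- r | P i) u i)%g k = \sum_(i <- r | P i) char_digit (u i) k.
Proof.
apply: (big_morph (fun chi : character R p => char_digit chi k)) => [chi chi'|].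
  exact: char_digitM.
by apply: (@zeta_inj R); rewrite -char_digitE zeta0.
Qed.

(** The product of Rademacher characters with the same digits at places [- N], ..., 0 has the same
    value of [m0], which [is_mask] prescribes. *)
Lemma m0E chi : m0 chi = lam (window N.+1 (char_digit chi) 0).
Proof.
rewrite -(m0P.1 _ 1%g)//; apply: m0_digits => j jN.
have jN' : (j < N.+1)%N by [].
rewrite mul1g char_digit_prod (bigD1 (Ordinal jN'))//= big1 ?addr0 => [|i ij].
  by rewrite char_digit_radX tnth_mktuple eqxx mul1r sub0r.
rewrite char_digit_radX; case: eqVneq => [/oppr_inj[ji]|]; last by rewrite mul0r.
by move/eqP: ij; case; apply: val_inj.
Qed.

Lemma m0_dilE chi (n : nat) : m0 (chi_dil (- n%:Z) chi) = lam (window N.+1 (char_digit chi) n%:Z).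
Proof.
rewrite m0E; congr lam; apply: eq_from_tnth => j; rewrite !tnth_mktuple char_digit_dil.
by congr char_digit; lia.
Qed.

Local Notation F := (scaling_hat m0).

Lemma lam_zero d k : (forall j, k - N.+1%:Z < j -> j <= k -> d j = 0) ->
  lam (window N.+1 d k) = 1.
Proof. by move=> d0; rewrite window_zero// lamP.1. Qed.

(** From [n = s + N] on, the window read at [n] is zero and the factor is 1, so the partial products
    stabilize. *)
Lemma F_prod chi (s K : nat) : (forall k, s%:Z <= k -> char_digit chi k = 0) -> (s + N <= K)%N ->
  F chi = \prod_(0 <= n < K) m0 (chi_dil (- n%:Z) chi).
Proof.
move=> cs sK; apply: (@cvg_lim ((R[i] : numFieldType)^o)); first exact: norm_hausdorff.
apply: cvg_near_cst; exists K => // K' /= KK'.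
rewrite (big_cat_nat (n := K))//= [X in _ * X]big_nat_cond.
rewrite [X in _ * X]big1 ?mulr1// => n /andP[/andP[Kn _] _].
by rewrite m0_dilE lam_zero// => j jn _; apply: cs; lia.
Qed.

Lemma char_digit_bound chi : exists s : nat, forall k, s%:Z <= k -> char_digit chi k = 0.
Proof.
have [n chin] := char_lc chi; exists (absz n) => k nk.
by apply: (char_digit_annih chin); lia.
Qed.

(** The factors read only digits at places at least [- N], where those of [xi] vanish. *)
Lemma F_annih chi xi : annih R p (- N%:Z) xi -> F (chi * xi)%g = F chi.
Proof.
move=> xiN; rewrite /scaling_hat (_ : (fun k : nat => _) =
  (fun k : nat => \prod_(0 <= n < k) m0 (chi_dil (- n%:Z) chi)))//.
apply/funext => K; apply: eq_bigr => n _; rewrite !m0_dilE; congr lam.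
apply: eq_from_tnth => j; rewrite !tnth_mktuple char_digitM (char_digit_annih xiN) ?addr0//.
have := ltn_ord j; lia.
Qed.

(** The factor [n = 0] is split off the stabilized product; the others form the product for the
    dilated character. *)
Lemma F_refine chi : F chi = m0 chi * F (chi_dil (-1) chi).
Proof.
have [s cs] := char_digit_bound chi.
rewrite (@F_prod chi s (s + N).+1)// (@F_prod (chi_dil (-1) chi) s (s + N))//; last first.
  by move=> k sk; rewrite char_digit_dil cs//; lia.
rewrite big_nat_recl//=; congr (_ * _).
  by congr m0; apply: eq_character => x /=; rewrite dil0.
apply: eq_bigr => n _; rewrite !m0_dilE; congr lam.
apply: eq_from_tnth => j; rewrite !tnth_mktuple char_digit_dil; congr char_digit; lia.
Qed.

Hypotheses (N0 : (0 < N)%N) (vt : valid_tree N t).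

(** Powers of [rad R p 0] change only the top digit of the window, which is the setting of
    [lam_ex]. *)
Lemma m0_ex chi : exists c0 : 'Z_p, forall c : 'Z_p,
  `|m0 (chi * rad R p 0 ^+ c)%g| = (c == c0)%:R.
Proof.
have [c0 c0P] := lam_ex N0 vt lamP (window N (char_digit chi) (-1)).
exists (c0 - char_digit chi 0) => c; rewrite m0E window_cons.
have -> : window N (char_digit (chi * rad R p 0 ^+ c)%g) (0 - 1) = window N (char_digit chi) (-1).
  apply: eq_from_tnth => j; rewrite !tnth_mktuple sub0r char_digitM char_digit_radX.
  by rewrite (_ : (_ == 0) = false) ?mul0r ?addr0//; lia.
by rewrite c0P char_digitM char_digit_radX eqxx mul1r [in RHS]eq_sym subr_eq eq_sym addrC.
Qed.

(** The quadrature mirror filter condition. *)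
Lemma m0_sum chi : \sum_(c : 'Z_p) `|m0 (chi * rad R p 0 ^+ c)%g| ^+ 2 = 1.
Proof.
have [c0 c0P] := m0_ex chi; rewrite (bigD1 c0)//= c0P eqxx expr1n big1 ?addr0// => c cc0.
by rewrite c0P (negbTE cc0) expr0n.
Qed.

Local Notation S := (depth vt).

(** If the first [s] factors are nonzero, [depth_zero] kills the [N] digits below place [s], so all
    the later windows are zero; otherwise both sides vanish. *)
Lemma F_short chi (s : nat) : (S <= s)%N -> (forall k, s%:Z <= k -> char_digit chi k = 0) ->
  F chi = \prod_(0 <= n < s) m0 (chi_dil (- n%:Z) chi).
Proof.
move=> Ss cs; rewrite (F_prod cs (leqnn _)) (big_cat_nat (n := s)) ?leq_addr//=.
have [->|nz] := eqVneq (\prod_(0 <= n < s) m0 (chi_dil (- n%:Z) chi)) 0.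
  by rewrite mul0r.
rewrite [X in _ * X]big_nat_cond [X in _ * X]big1 ?mulr1// => n /andP[/andP[sn _] _].
rewrite m0_dilE lam_zero// => j jn _.
have [/cs//|js] := leP s%:Z j.
apply: (depth_zero N0 (d := char_digit chi) lamP Ss) => //; last by lia.
move=> i si; rewrite -m0_dilE.
by move: nz; rewrite big_mkord => /prodf_neq0/(_ (Ordinal si) isT).
Qed.

(** If [F chi] were nonzero, so would be the factors 0, ..., [k], and [depth_zero] would force the
    digit at [k] to vanish. This makes the spectrum bounded. *)
Lemma F_vanish chi (k : nat) : (S <= k)%N -> char_digit chi k%:Z != 0 -> F chi = 0.
Proof.
move=> Sk dk; have [s cs] := char_digit_bound chi.
have ks : k%:Z < s%:Z by rewrite ltNge; apply: contra dk => /cs ->.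
rewrite (F_prod cs (leqnn _)).
apply/eqP; apply: contraT => nz; move/eqP: dk; case.
apply: (depth_zero N0 (d := char_digit chi) lamP (leqW Sk)); [|lia|lia].
move=> n nk; have ns : (n < s + N)%N by lia.
rewrite -m0_dilE.
by move: nz; rewrite big_mkord => /prodf_neq0/(_ (Ordinal ns) isT).
Qed.

End Mask.

(** * The scaling function *)

Section Scaling.
Variables (R : realType) (p N : nat).
Variables (mu : {measure set (vilenkin p) -> \bar R}).
Variables (nu : {measure set (character R p) -> \bar R}).
Variables (t : ltree 'Z_p) (lam : N.+1.-tuple 'Z_p -> R[i]) (m0 : character R p -> R[i]).
Variables phi beta : vilenkin p -> R[i].
Hypotheses (p1 : (1 < p)%N) (N0 : (0 < N)%N).
Hypotheses (hmu : haar_vilenkin mu) (hnu : haar_character nu).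
Hypotheses (vt : valid_tree N t) (lamP : mask_values t lam).
Hypotheses (m0P : is_mask lam m0) (betaP : mask_coefs N m0 beta).
Hypotheses (Lphi : L2 mu phi) (phiP : is_fourier mu nu phi (scaling_hat m0)).
Implicit Types (chi xi : character R p) (k : int) (x y h : vilenkin p).
Local Notation F := (scaling_hat m0).
Local Notation S := (depth vt).

Lemma phi_char_on (m : nat) chi : (N <= m)%N -> inner mu phi (char_on (- m%:Z) chi) = F chi.
Proof.
apply: (fourier_exact p1 hmu hnu Lphi _ phiP) => xi eta; exact: (F_annih m0P betaP).
Qed.

Lemma char_on_shift n h chi x : subG p n h -> char_on n chi x = chi h * char_on n chi (x - h).
Proof.
move=> hn; rewrite /char_on mulrCA -charD subrKC; congr (_ * _).
by have := cind_lc R 0 (x - h) hn; rewrite subrK.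
Qed.

Lemma phi_shift_char_on (m : nat) h chi : (N <= m)%N -> subG p (- m%:Z) h ->
  inner mu (shiftf h phi) (char_on (- m%:Z) chi) = (chi h)^*%C * F chi.
Proof.
move=> Nm hm.
have -> : char_on (- m%:Z) chi = (fun x => chi h * shiftf h (char_on (- m%:Z) chi) x).
  by apply/funext => x; rewrite {1}(char_on_shift _ _ hm).
rewrite innerZr ?inner_shift ?phi_char_on//.
- exact: L2_char_on.
- by apply: L2_shift => //; exact: L2_char_on.
- exact: L2_shift.
Qed.

(** By [F_vanish], only the power 0 of each further Rademacher character contributes. *)
Lemma F_tail (m : nat) y (k : nat) : (S <= k)%N ->
  \sum_(chi <- char_reps R p (- m%:Z) (m + k)) chi y * F chi =
  \sum_(chi <- char_reps R p (- m%:Z) (m + S)) chi y * F chi.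
Proof.
elim: k => [|k IH]; first by rewrite leqn0 => /eqP ->.
rewrite leq_eqVlt => /orP[/eqP ->//|Sk]; rewrite -IH// addnS char_reps_recr.
apply: eq_big_seq => chi /char_reps_annih; rewrite PoszD addKr => chik.
rewrite (bigD1 0)//= expg0 mulg1 mulr1 big1 ?addr0// => a a0.
rewrite (F_vanish lamP m0P betaP N0 (k := k)) ?mulr0//.
by rewrite char_digitM char_digit_radX eqxx mul1r (char_digit_annih chik)// add0r.
Qed.

(** Fourier inversion as a finite sum, cut off outside G_(-m): for [N <= m], [F] is constant on the
    cosets of [annih R p (- m)], of measure p^(-m), and vanishes if a digit at a place at least [S]
    is nonzero. *)
Definition phi_trig (m : nat) x : R[i] := (p%:R ^+ m)^-1 *
  \sum_(chi <- char_reps R p (- m%:Z) (m + S)) F chi * char_on (- m%:Z) chi x.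

Lemma L2_phi_trig (m : nat) : L2 mu (phi_trig m).
Proof. by apply/L2Z/L2_sum => chi _; apply/L2Z/L2_char_on. Qed.

Lemma phi_trig_lc (m : nat) x z : subG p S%:Z z -> phi_trig m (x + z) = phi_trig m x.
Proof.
move=> zS; congr (_ * _); apply: eq_big_seq => chi /char_reps_annih; rewrite PoszD addKr => chiS.
rewrite /char_on charD (chiS z)// mulr1 cind_lc//; apply: subG_le zS; lia.
Qed.

Lemma phi_trig_cind (m : nat) y k : S%:Z <= k ->
  inner mu (phi_trig m) (cind R y k) = phi_trig m y * (p%:R ^ (- k))%:C%C.
Proof.
move=> Sk; have -> : inner mu (phi_trig m) (cind R y k) =
    inner mu (fun x => phi_trig m y * cind R y k x) (cind R y k).
  congr cintegral; apply/funext => x; rewrite /cind; case: asboolP => xy.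
    rewrite rmorph1 !mulr1 -[in LHS](subrKC y x) phi_trig_lc//.
    exact: (subG_le Sk xy).
  by rewrite rmorph0 !mulr0.
rewrite innerZl; [|exact: L2_cind..]; congr (_ * _).
have E x : cind R y k x * (cind R y k x)^*%C = (\1_(coset y k) x : R)%:C%C.
  by rewrite mul_conjE normsq_cind.
rewrite /inner /cintegral /Rintegral.
have -> : (\int[mu]_x (complex.Re (cind R y k x * (cind R y k x)^*%C))%:E
           = (p%:R ^ (- k))%:E)%E.
  rewrite -(haar_coset hmu y) -[in RHS](setIT (coset y k)) -integral_indic//.
    by apply: eq_integral => x _; rewrite E.
  exact: measurable_coset.
by rewrite integral0_eq// => x _; rewrite E.
Qed.

(** Both functions have the same integral over every coset of level at least [S]: inside G_(-m) by
    finite Fourier inversion, outside because both integrals vanish. *)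
Lemma phi_trig_null (m : nat) : (N <= m)%N -> sqint mu (fun x => phi x - phi_trig m x) = 0%E.
Proof.
move=> Nm; have LB := L2B Lphi (L2_phi_trig m).
apply: (@null_of_cind_ge _ _ _ p1 hmu S%:Z) => // y k Sk.
have [k' kE] : exists k' : nat, k = k'%:Z by exists (absz k); lia.
rewrite innerBl//; [|exact: L2_phi_trig|exact: L2_cind].
rewrite phi_trig_cind// kE; apply/eqP; rewrite subr_eq0; apply/eqP.
have Sk' : (S <= k')%N by rewrite -lez_nat -kE.
have [ym|nym] := pselect (subG p (- m%:Z) y).
  rewrite (_ : k'%:Z = - m%:Z + (m + k')%N%:Z); last by lia.
  rewrite inner_cind_reps//; under eq_bigr do rewrite phi_char_on//.
  rewrite F_tail// /phi_trig.
  under [in RHS]eq_bigr do rewrite /char_on /cind coset0 asboolT// mul1r mulrC.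
  rewrite PoszD addKr exprD invfM mulrAC; congr (_ * _ * _).
  by rewrite -exprnN fmorphV rmorphXn rmorph_nat.
have dis x : coset y k'%:Z x -> ~ subG p (- m%:Z) x.
  move=> xy xm; apply: nym; rewrite (_ : y = x - (x - y)); last by rewrite opprB addrC subrK.
  by apply: subGB => //; apply: subG_le xy; lia.
have -> : phi_trig m y = 0.
  by rewrite /phi_trig big1 ?mulr0// => chi _; rewrite /char_on /cind coset0 asboolF// mul0r mulr0.
rewrite mul0r.
(* For [y] outside G_(-m), inversion is done on a larger G_(-m'). The coefficients of [phi] over
   both groups are [F], so the truncation to G_(-m') may be replaced by that to G_(-m), where the
   resulting multiple of the coset indicator is zero. *)
have [m1 ym1] := subG_exists y; pose m' := maxn m m1.
have ym' : subG p (- m'%:Z) y by apply: subG_le ym1; lia.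
rewrite (_ : k'%:Z = - m'%:Z + (m' + k')%N%:Z); last by lia.
rewrite inner_cind_reps//.
have -> : \sum_(chi <- char_reps R p (- m'%:Z) (m' + k'))
                      chi y * inner mu phi (char_on (- m'%:Z) chi)
    = inner mu phi (fun x => \sum_(chi <- char_reps R p (- m'%:Z) (m' + k'))
                      (chi y)^*%C * char_on (- m%:Z) chi x).
  rewrite inner_sumr//; last by move=> chi _; apply/L2Z/L2_char_on.
  apply: eq_bigr => chi _; rewrite innerZr//; last exact: L2_char_on.
  by rewrite conjcK !phi_char_on// (leq_trans Nm)// leq_maxl.
rewrite (_ : (fun x => _) = (fun=> 0)) ?(inner_conj (L20 mu) Lphi) ?inner0l ?rmorph0 ?mulr0//.
apply/funext => x; rewrite /char_on /cind !coset0.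
have [xm|nxm] := asboolP (subG p (- m%:Z) x); last first.
  by rewrite big1// => chi _; rewrite mul0r mulr0.
have := cind_reps R p1 (m' + k') x ym'.
rewrite (_ : _ + (m' + k')%N%:Z = k'%:Z); last by lia.
rewrite /cind asboolF => [/esym/eqP|/dis]; last exact.
rewrite mulf_eq0 invr_eq0 expf_eq0 (negbTE (pR_neq0 _ p1)) andbF => /eqP.
rewrite /char_on /cind coset0 asboolT//; last by apply: subG_le xm; lia.
Qed.

(** Summing over the top digit first: only the last factor depends on it, and [m0_sum] makes that
    sum 1. *)
Lemma mask_prod_sum (m s : nat) (G : character R p -> R[i]) :
  (forall chi (k : nat) (a : 'Z_p), G (chi * rad R p k%:Z ^+ a)%g = G chi) ->
  \sum_(chi <- char_reps R p (- m%:Z) (m + s))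
     `|\prod_(0 <= n < s) m0 (chi_dil (- n%:Z) chi)| ^+ 2 * G chi =
  \sum_(chi <- char_reps R p (- m%:Z) m) G chi.
Proof.
move=> Ginv; elim: s => [|s IH].
  by rewrite addn0; apply: eq_bigr => chi _; rewrite big_nil normr1 expr1n mul1r.
rewrite -IH addnS char_reps_recr; apply: eq_bigr => chi _; rewrite PoszD addKr.
rewrite -[RHS]mulr1 -[X in _ = _ * X](m0_sum lamP m0P betaP N0 vt (chi_dil (- s%:Z) chi)) mulr_sumr.
apply: eq_bigr => a _; rewrite Ginv [RHS]mulrAC -exprMn -normrM; congr (`|_| ^+ 2 * _).
rewrite big_nat_recr//=; congr (_ * _).
  apply: eq_big_nat => n /andP[_ ns]; apply: (m0_digits betaP) => j _.
  rewrite !char_digit_dil char_digitM char_digit_radX (_ : (_ == _) = false) ?mul0r ?addr0//.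
  by apply/negP => /eqP; lia.
apply: (m0_digits betaP) => j _; rewrite char_digit_dil !char_digitM !char_digit_radX char_digit_dil.
by congr (_ + (nat_of_bool _)%:R * _); apply/eqP/eqP; lia.
Qed.

(** Characters [rad R p k] with [k >= 0] are 1 on [H0], so [mask_prod_sum] leaves a plain character
    sum over the negative places. *)
Lemma F_sqr_sum (m : nat) h : H0 p h -> subG p (- m%:Z) h ->
  \sum_(chi <- char_reps R p (- m%:Z) (m + S)) `|F chi| ^+ 2 * (chi h)^*%C =
  p%:R ^+ m * (h == 0)%:R.
Proof.
move=> /H0P h0 hm.
transitivity (\sum_(chi <- char_reps R p (- m%:Z) (m + S))
     `|\prod_(0 <= n < S) m0 (chi_dil (- n%:Z) chi)| ^+ 2 * (chi h)^*%C).
  apply: eq_big_seq => chi /char_reps_annih; rewrite PoszD addKr => chiS.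
  rewrite (F_short lamP m0P betaP N0 (leqnn _))// => k Sk; exact: char_digit_annih chiS Sk.
rewrite mask_prod_sum => [|chi k a]; last first.
  by rewrite characterM charX radE h0// zeta0 expr1n mulr1.
under eq_bigr do rewrite char_conj.
rewrite char_reps_sum natrM natrX Zp_trunc_pR//; congr (_ * (nat_of_bool _)%:R).
apply/forallP/eqP => [hz|-> j]; last by rewrite -[- 0]add0r digitB subrr.
apply: vilenkinP => k; have [k0|k0] := leP 0 k; first by rewrite h0.
have [km|km] := ltP k (- m%:Z); first by rewrite hm.
have km' : (absz (k + m%:Z)%R < m)%N by lia.
have := hz (Ordinal km'); rewrite -[- h]sub0r digitB digit0 sub0r oppr_eq0 => /eqP.
by rewrite (_ : _ + _ = k)//=; lia.
Qed.

(** A finite Parseval identity: replacing one factor by [phi_trig] turns the inner product into the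
    sum of [F_sqr_sum]. *)
Lemma phi_ortho h h' : H0 p h -> H0 p h' ->
  inner mu (shiftf h phi) (shiftf h' phi) = (h == h')%:R.
Proof.
move=> h0 h'0; rewrite inner_shift2// -subr_eq0; move: (h - h') (H0B h0 h'0) => {h0 h'0}h h0.
have [m1 hm1] := subG_exists h; pose m := maxn N m1.
have hm : subG p (- m%:Z) h by apply: subG_le hm1; lia.
have Nm : (N <= m)%N by exact: leq_maxl.
have Lt := L2_phi_trig m; have Ls := L2_shift hmu h Lphi.
have -> : inner mu (shiftf h phi) phi = inner mu (shiftf h phi) (phi_trig m).
  apply/eqP; rewrite -subr_eq0 -innerBr//; apply/eqP.
  rewrite (inner_conj (L2B Lphi Lt) Ls) (inner_null_l (L2B Lphi Lt) Ls) ?rmorph0//.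
  exact: phi_trig_null.
have Le chi : L2 mu (fun x => F chi * char_on (- m%:Z) chi x) by apply/L2Z/L2_char_on.
rewrite innerZr//; last by apply: L2_sum.
rewrite inner_sumr// fmorphV rmorphXn rmorph_nat.
under eq_bigr => chi _.
  rewrite innerZr//; last exact: L2_char_on.
  rewrite phi_shift_char_on// mulrCA mulrC (mulrC _ (F chi)) -sqr_normc.
  over.
by rewrite F_sqr_sum// mulKf// expf_neq0// pR_neq0.
Qed.

(** The refinement equation, which holds almost everywhere because both sides have equal Fourier
    coefficients by [F_refine]. *)
Lemma phi_refine_null :
  sqint mu (fun x => phi x - \sum_(h <- H0seq p N) beta h * phi (dil 1 x - h)) = 0%E.
Proof.
have Ld h : L2 mu (fun x => phi (dil 1 x - h)).
  by have := L2_dilf p1 hmu (L2_shift hmu h Lphi).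
have Ls : L2 mu (fun x => \sum_(h <- H0seq p N) beta h * phi (dil 1 x - h)).
  by apply: L2_sum => h _; exact: L2Z.
apply: (@null_of_char_on _ _ _ p1 hmu N) => [|m chi Nm]; first exact: L2B.
have Le := L2_char_on hmu (- m%:Z) chi.
rewrite innerBl// phi_char_on// inner_suml//; last by move=> h _; exact: L2Z.
(* Undoing the dilation enlarges the domain of truncation by one level. *)
have eE : char_on (- m%:Z) chi = dilf (char_on (- m.+1%:Z) (chi_dil (-1) chi)).
  apply/funext => x; rewrite /char_on /dilf /= dilK; congr (_ * _).
  rewrite /cind !coset0; congr (_%:R); congr (nat_of_bool _).
  apply/asboolP/asboolP => [xm|/subG_dil]; first apply/subG_dil.
    by rewrite (_ : - m.+1%:Z + 1 = - m%:Z)//; lia.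
  by rewrite (_ : - m.+1%:Z + 1 = - m%:Z)//; lia.
rewrite (F_refine lamP m0P betaP) betaP sum_H0seq mulrC mulrCA !mulr_sumr.
apply/eqP; rewrite subr_eq0; apply/eqP; apply: eq_big_seq => h hH.
rewrite innerZl// eE.
rewrite (inner_dilf p1 hmu (L2_shift hmu h Lphi) (L2_char_on hmu _ _)).
rewrite phi_shift_char_on ?(leqW Nm)//; last first.
  by move=> k km; rewrite (H0seqP hH)//; apply/orP; right; lia.
set c := (_^*%C); set f := F _; ring.
Qed.

End Scaling.

(** * Wavelets *)

Section MaskCoefficients.
Variables (R : realType) (p N : nat) (t : ltree 'Z_p).
Variables (lam : N.+1.-tuple 'Z_p -> R[i]) (m0 : character R p -> R[i]).
Variables beta : vilenkin p -> R[i].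
Hypotheses (p1 : (1 < p)%N) (N0 : (0 < N)%N).
Hypotheses (vt : valid_tree N t) (lamP : mask_values t lam).
Hypotheses (m0P : is_mask lam m0) (betaP : mask_coefs N m0 beta).
Implicit Types (chi xi : character R p) (k : int) (x y h : vilenkin p).
Implicit Types (a b c l : 'Z_p).
Local Notation H0seq := (H0seq p N).

Lemma conjcX (z : R[i]) (n : nat) : (z ^+ n)^*%C = z^*%C ^+ n.
Proof. exact: rmorphXn. Qed.

Lemma conjcM (z w : R[i]) : (z * w)^*%C = z^*%C * w^*%C.
Proof. exact: rmorphM. Qed.

Lemma zeta_sum2 a b : \sum_(l : 'Z_p) zeta R a ^+ l * (zeta R b ^+ l)^*%C = p%:R * (a == b)%:R.
Proof.
under eq_bigr do rewrite conjcX -exprMn -zetaN -zetaD.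
by rewrite zeta_sum natrM Zp_trunc_pR// subr_eq0.
Qed.

(** Multiplying [chi] by [rad R p 0 ^+ a] multiplies the term of [h] by a conjugate power of
    [zeta R (h (-1))]; summing against [zeta R c ^+ a] isolates one residue class. *)
Lemma mask_component chi c :
  \sum_(h <- H0seq | h (-1) == c) beta h * (chi (dil (-1) h))^*%C =
  \sum_(a : 'Z_p) zeta R c ^+ a * m0 (chi * rad R p 0 ^+ a)%g.
Proof.
under [RHS]eq_bigr do rewrite betaP sum_H0seq mulrCA mulr_sumr.
rewrite -mulr_sumr exchange_big /= big_mkcond /= mulr_sumr; apply: eq_bigr => h _.
rewrite (eq_bigr (fun a : 'Z_p => beta h * (chi (dil (-1) h))^*%C *
    (zeta R c ^+ a * (zeta R (h (-1)) ^+ a)^*%C))) => [|a _]; last first.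
  rewrite charX radE digit_dil sub0r conjcM mulrCA -[RHS]mulrA; congr (_ * _).
  exact: mulrCA.
rewrite -mulr_sumr zeta_sum2 eq_sym mulrCA mulKf ?pR_neq0//.
by case: eqP; rewrite ?mulr1 ?mulr0.
Qed.

(** By [m0_ex] a single term of the sum in [mask_component] survives, and it has modulus 1. *)
Lemma mask_component_sqr chi c :
  (\sum_(h <- H0seq | h (-1) == c) beta h * (chi (dil (-1) h))^*%C) *
  (\sum_(h <- H0seq | h (-1) == c) beta h * (chi (dil (-1) h))^*%C)^*%C = 1.
Proof.
have [c0 c0P] := m0_ex lamP m0P betaP N0 vt chi.
rewrite mask_component -sqr_normc (bigD1 c0)//= big1 ?addr0 => [|a ac0]; last first.
  by apply/eqP; rewrite -normr_eq0 normrM c0P (negbTE ac0) mulr0.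
by rewrite normrM normrX zeta_norm expr1n c0P eqxx mul1r expr1n.
Qed.

Lemma H0seqB h j : h \in H0seq -> j \in H0seq -> h - j \in H0seq.
Proof.
move=> /H0seqP hH /H0seqP jH; rewrite mem_H0seq; apply/mem_set/H0sP => k kN.
by rewrite digitB hH// jH// subrr.
Qed.

Lemma H0seq_uniq : uniq H0seq. Proof. exact: finmap.fset_uniq. Qed.

(** Fourier inversion on the finite group [H0s p N.+1], moved by [dil (-1)] to the places [- N],
    ..., 0 that the characters in [char_reps] separate. *)
Lemma H0seq_fourier (G : vilenkin p -> R[i]) w : w \in H0seq ->
  G w = (p%:R ^+ N.+1)^-1 * \sum_(chi <- char_reps R p (- N%:Z) N.+1)
    (chi (dil (-1) w))^*%C * \sum_(z <- H0seq) G z * chi (dil (-1) z).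
Proof.
move=> wH; under eq_bigr do rewrite mulr_sumr; rewrite exchange_big /=.
rewrite (bigD1_seq w) ?H0seq_uniq//=.
have E z : \sum_(chi <- char_reps R p (- N%:Z) N.+1)
    (chi (dil (-1) w))^*%C * (G z * chi (dil (-1) z)) =
    G z * (p%:R ^+ N.+1 * [forall j : 'I_N.+1, dil (-1) (z - w) (- N%:Z + j%:Z) == 0]%:R).
  under eq_bigr do rewrite mulrCA char_conj -charD (addrC (- _)) -dilB.
  by rewrite -mulr_sumr char_reps_sum natrM natrX Zp_trunc_pR.
rewrite E subrr dil_0 (_ : [forall j, _] = true); last by apply/forallP.
rewrite big_seq_cond big1 => [|z /andP[zH zw]].
  by rewrite addr0 mulr1 mulrCA mulVf ?mulr1// expf_neq0// pR_neq0.
rewrite E (_ : [forall j, _] = false) ?mulr0//; apply/negbTE/negP => /forallP zw0.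
move/eqP: zw; apply; apply/eqP; rewrite -subr_eq0; apply/eqP/vilenkinP => k.
have [k0|k0] := leP 0 k; first by apply: (H0seqP (H0seqB zH wH)); rewrite k0.
have [km|km] := ltP k (- N.+1%:Z); first by apply: (H0seqP (H0seqB zH wH)); rewrite km orbT.
have km' : (absz (k + N.+1%:Z)%R < N.+1)%N by lia.
have := zw0 (Ordinal km'); rewrite digit_dil digit0 => /eqP <-; congr (digit _ _).
by rewrite /=; lia.
Qed.

(* Each residue class of coefficients has autocorrelation the unit mass at 0,
   because its trigonometric polynomial is unimodular. *)
Lemma beta_class c (G : vilenkin p -> R[i]) :
  \sum_(h <- H0seq | h (-1) == c) \sum_(j <- H0seq | j (-1) == c)
    beta h * (beta j)^*%C * G (h - j) = G 0.
Proof.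
pose Gh chi := \sum_(z <- H0seq) G z * chi (dil (-1) z).
have H0 : 0 \in H0seq by rewrite mem_H0seq; apply/mem_set/H0sP.
rewrite [RHS](H0seq_fourier _ H0) dil_0; under [in RHS]eq_bigr do rewrite char0 rmorph1 mul1r.
transitivity ((p%:R ^+ N.+1)^-1 * \sum_(chi <- char_reps R p (- N%:Z) N.+1) Gh chi *
  ((\sum_(h <- H0seq | h (-1) == c) beta h * (chi (dil (-1) h))^*%C) *
   (\sum_(h <- H0seq | h (-1) == c) beta h * (chi (dil (-1) h))^*%C)^*%C)); last first.
  by congr (_ * _); apply: eq_bigr => chi _; rewrite mask_component_sqr mulr1.
have E chi : Gh chi *
  ((\sum_(h <- H0seq | h (-1) == c) beta h * (chi (dil (-1) h))^*%C) *
   (\sum_(h <- H0seq | h (-1) == c) beta h * (chi (dil (-1) h))^*%C)^*%C) =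
  \sum_(h <- H0seq | h (-1) == c) \sum_(j <- H0seq | j (-1) == c)
    Gh chi * (beta h * (chi (dil (-1) h))^*%C * (beta j * (chi (dil (-1) j))^*%C)^*%C).
  rewrite rmorph_sum mulr_suml mulr_sumr; apply: eq_bigr => h _.
  by rewrite !mulr_sumr.
under [in RHS]eq_bigr do rewrite E.
rewrite [in RHS]exchange_big mulr_sumr big_seq_cond [RHS]big_seq_cond.
apply: eq_bigr => h /andP[hH _].
rewrite exchange_big mulr_sumr big_seq_cond [RHS]big_seq_cond.
apply: eq_bigr => j /andP[jH _].
rewrite (H0seq_fourier G (H0seqB hH jH)) mulrCA mulr_sumr; congr (_ * _); apply: eq_bigr => chi _.
by rewrite -/(Gh chi) conjcM conjcK dilB charD -char_conj conjcM conjcK; ring.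
Qed.

(** Only pairs with equal digits at -1 contribute; on each such class the weights are constant and
    [beta_class] applies. *)
Lemma beta_corr (w w' : 'Z_p -> R[i]) (G : vilenkin p -> R[i]) :
  (forall x, x (-1) != 0 -> G x = 0) ->
  \sum_(h <- H0seq) \sum_(j <- H0seq)
    (beta h * w (h (-1))) * (beta j * w' (j (-1)))^*%C * G (h - j) =
  (\sum_(c : 'Z_p) w c * (w' c)^*%C) * G 0.
Proof.
move=> G0; rewrite mulr_suml.
under [RHS]eq_bigr => c _.
  rewrite -(beta_class c G) mulr_sumr big_mkcond /=.
  over.
rewrite [RHS]exchange_big; apply: eq_bigr => h _ /=.
rewrite -big_mkcond /= (bigD1 (h (-1)))//= [X in _ + X]big1 ?addr0; last first.
  by move=> c /andP[/eqP <-]; rewrite eqxx.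
rewrite mulr_sumr [RHS]big_mkcond /=; apply: eq_bigr => j _.
case: eqVneq => [->|jh]; first by rewrite conjcM; ring.
by rewrite G0 ?mulr0// digitB subr_eq0 eq_sym.
Qed.

End MaskCoefficients.

(** * Linear spans and orthogonality *)

Section Spans.
Context (d : measure_display) (T : measurableType d) (R : realType).
Variable mu : {measure set T -> \bar R}.
Implicit Types (f g : T -> R[i]) (S W : set (T -> R[i])).

Lemma linear_span_gen S f : S f -> linear_span S f.
Proof.
move=> Sf; exists 1%N, (fun=> 1), (fun=> f); split => //.
by apply/funext => x; rewrite big_ord1 mul1r.
Qed.

Lemma linear_spanD S f g : linear_span S f -> linear_span S g ->
  linear_span S (fun x => f x + g x).
Proof.
move=> [n [c [u [Su ->]]]] [m [e [v [Sv ->]]]].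
exists (n + m)%N, (fun i => match fintype.split i with inl j => c j | inr j => e j end),
  (fun i => match fintype.split i with inl j => u j | inr j => v j end); split.
  by move=> i; case: fintype.split.
apply/funext => x; rewrite big_split_ord; congr (_ + _); apply: eq_bigr => i _.
  by rewrite (unsplitK (inl i)).
by rewrite (unsplitK (inr i)).
Qed.

Lemma linear_spanZ S (a : R[i]) f : linear_span S f -> linear_span S (fun x => a * f x).
Proof.
move=> [n [c [u [Su ->]]]]; exists n, (fun i => a * c i), u; split => //.
by apply/funext => x; rewrite mulr_sumr; apply: eq_bigr => i _; rewrite mulrA.
Qed.

Lemma linear_span0 S : linear_span S (fun=> 0).
Proof.
exists 0%N, (fun=> 0), (fun _ _ => 0); split; first by case.
by apply/funext => x; rewrite big_ord0.
Qed.

Lemma linear_span_sum S (I : Type) (r : seq I) (P : pred I) (u : I -> T -> R[i]) :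
  (forall i, P i -> linear_span S (u i)) ->
  linear_span S (fun x => \sum_(i <- r | P i) u i x).
Proof.
move=> Su; elim: r => [|i r IH].
  by under eq_fun do rewrite big_nil; exact: linear_span0.
have [Pi|/negbTE Pi] := boolP (P i); last by under eq_fun do rewrite big_cons Pi.
by under eq_fun do rewrite big_cons Pi; apply: linear_spanD => //; exact: Su.
Qed.

Lemma linear_span_sum_seq S (I : eqType) (r : seq I) (P : pred I) (u : I -> T -> R[i]) :
  (forall i, i \in r -> P i -> linear_span S (u i)) ->
  linear_span S (fun x => \sum_(i <- r | P i) u i x).
Proof.
move=> Su; under eq_fun do rewrite big_seq_cond.
by apply: linear_span_sum => i /andP[]; exact: Su.
Qed.

Lemma linear_spanU S W f : linear_span (S `|` W) f ->
  exists f0 f1, [/\ linear_span S f0, linear_span W f1 & f = (fun x => f0 x + f1 x)].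
Proof.
move=> [n [c [u [Su ->]]]].
exists (fun x => \sum_(i < n | `[< S (u i) >]) c i * u i x),
  (fun x => \sum_(i < n | ~~ `[< S (u i) >]) c i * u i x); split.
- by apply: linear_span_sum => i /asboolP Si; apply/linear_spanZ/linear_span_gen.
- apply: linear_span_sum => i /asboolPn Si; apply/linear_spanZ/linear_span_gen.
  by case: (Su i).
- by apply/funext => x; rewrite (bigID (fun i => `[< S (u i) >])).
Qed.

Lemma linear_span_sub S W : S `<=` linear_span W -> linear_span S `<=` linear_span W.
Proof.
move=> SW f [n [c [u [Su ->]]]].
by apply: linear_span_sum => i _; apply/linear_spanZ/SW.
Qed.

Lemma linear_span_L2 S f : S `<=` L2 mu -> linear_span S f -> L2 mu f.
Proof.
by move=> SL [n [c [u [Su ->]]]]; apply: L2_sum => i _; apply/L2Z/SL.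
Qed.

Lemma closed_span_gen S : S `<=` L2 mu -> S `<=` closed_span mu S.
Proof.
move=> SL f Sf; split; first exact: SL.
move=> e e0; exists f; first exact: linear_span_gen.
rewrite L2norm_lt//; under eq_fun do rewrite subrr.
rewrite /sqint integral0_eq ?lte_fin ?exprn_gt0// => x _.
by rewrite /normsq /= expr0n addr0.
Qed.

Lemma closed_span_sub S W : S `<=` linear_span W -> closed_span mu S `<=` closed_span mu W.
Proof.
move=> SW f [Lf fS]; split => // e /fS[g Sg fg].
by exists g => //; exact: linear_span_sub Sg.
Qed.

Lemma inner_linear_span S f g : S `<=` L2 mu -> L2 mu f ->
  (forall s, S s -> inner mu f s = 0) -> linear_span S g -> inner mu f g = 0.
Proof.
move=> SL Lf fS [n [c [u [Su ->]]]]; rewrite inner_sumr//; last first.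
  by move=> i _; apply/L2Z/SL.
by rewrite big1// => i _; rewrite innerZr ?fS ?mulr0//; exact: SL.
Qed.

Lemma inner_closed_span S f g : S `<=` L2 mu -> L2 mu f ->
  (forall s, S s -> inner mu f s = 0) -> closed_span mu S g -> inner mu f g = 0.
Proof.
move=> SL Lf fS [Lg gS]; apply: inner_eq0_approx => // e e0.
have se0 : 0 < Num.sqrt e by rewrite sqrtr_gt0.
have [h Sh gh] := gS _ se0; exists h.
  by split; [exact: linear_span_L2 Sh|exact: inner_linear_span Sh].
by move: gh; rewrite L2norm_lt// sqr_sqrtr// ltW.
Qed.

(** Pythagoras: [g] is orthogonal to [f - h], so subtracting it only increases the distance. *)
Lemma sqintB_le f g h : L2 mu f -> L2 mu g -> L2 mu h ->
  inner mu f g = 0 -> inner mu h g = 0 ->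
  (sqint mu (fun x => (f x - h x)%R) <= sqint mu (fun x => (f x - (g x + h x))%R))%E.
Proof.
move=> Lf Lg Lh fg hg; pose u x := f x - h x.
have Lu : L2 mu u by exact: L2B.
have ug : inner mu u g = 0 by rewrite innerBl// fg hg subrr.
have -> : (fun x => f x - (g x + h x)) = (fun x => u x - g x).
  by apply/funext => x; rewrite opprD addrA addrAC.
rewrite -/u; move: u Lu ug => u Lu ug; have Lug := L2B Lu Lg.
rewrite !sqint_inner// lee_fin innerBl// !innerBr// ug (inner_conj Lu Lg) ug rmorph0.
rewrite sub0r opprK subr0 raddfD /= lerDl -lee_fin -sqint_inner//; exact: sqint_ge0.
Qed.

End Spans.

(** * The wavelet family *)

Section Wavelets.
Variables (R : realType) (p N : nat).
Variables (mu : {measure set (vilenkin p) -> \bar R}).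
Variables (nu : {measure set (character R p) -> \bar R}).
Variables (t : ltree 'Z_p) (lam : N.+1.-tuple 'Z_p -> R[i]) (m0 : character R p -> R[i]).
Variables phi beta : vilenkin p -> R[i].
Hypotheses (p1 : (1 < p)%N) (N0 : (0 < N)%N).
Hypotheses (hmu : haar_vilenkin mu) (hnu : haar_character nu).
Hypotheses (vt : valid_tree N t) (lamP : mask_values t lam).
Hypotheses (m0P : is_mask lam m0) (betaP : mask_coefs N m0 beta).
Hypotheses (Lphi : L2 mu phi) (phiP : is_fourier mu nu phi (scaling_hat m0)).
Implicit Types (x y h k : vilenkin p) (l : nat).
Local Notation H0seq := (H0seq p N).

(** The generators of V_1, left unnormalized: they are orthogonal with squared norm 1/p. *)
Definition fine_phi h x : R[i] := phi (dil 1 x - h).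
Local Notation theta := fine_phi.

Lemma fine_phiE h : theta h = dilf (shiftf h phi).
Proof. by []. Qed.

Lemma L2_fine_phi h : L2 mu (theta h).
Proof. by rewrite fine_phiE; apply: L2_dilf => //; exact: L2_shift. Qed.

Lemma fine_phi_ortho h k : H0 p h -> H0 p k ->
  inner mu (theta h) (theta k) = p%:R^-1 * (h == k)%:R.
Proof.
move=> h0 k0; rewrite !fine_phiE inner_dilf//; try exact: L2_shift.
by rewrite (phi_ortho p1 N0 hmu hnu vt lamP m0P betaP Lphi phiP).
Qed.

Local Notation psi := (wavelet N beta phi).
Local Notation b l h := (beta h * zeta R (h (-1)) ^+ l).

Lemma waveletE l x : psi l x = \sum_(h <- H0seq) b l h * theta h x.
Proof.
rewrite /wavelet sum_H0seq; apply: eq_bigr => h _.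
by rewrite charX radE digit_dil sub0r.
Qed.

Lemma shift_waveletE l k :
  shiftf k (psi l) = (fun x => \sum_(h <- H0seq) b l h * theta (dil 1 k + h) x).
Proof.
apply/funext => x; rewrite /shiftf waveletE; apply: eq_bigr => h _.
by rewrite /fine_phi dilB opprD addrA.
Qed.

Lemma H0seq_H0 h : h \in H0seq -> H0 p h.
Proof. by move=> /H0seqP hH; apply/H0P => k k0; rewrite hH// k0. Qed.

Lemma H0_dil h : H0 p h -> H0 p (dil 1 h).
Proof. by move=> /H0P h0; apply/H0P => k k0; rewrite digit_dil h0//; lia. Qed.

Lemma L2_shift_wavelet l k : L2 mu (shiftf k (psi l)).
Proof.
by rewrite shift_waveletE; apply: L2_sum => h _; apply/L2Z/L2_fine_phi.
Qed.

(** Exchanges index and exponent, so that sums over residues [c] take the form of [zeta_sum2]. *)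
Lemma zeta_powE (c : 'Z_p) l : zeta R c ^+ l = zeta R (l%:R : 'Z_p) ^+ c.
Proof.
by rewrite -!zetaMn; congr zeta; rewrite -{1}(natr_Zp c) -!mulrnA mulnC.
Qed.

(** In the basis [fine_phi] the inner product is an autocorrelation of the coefficients, which
    [beta_corr] reduces to the orthogonality of roots of unity. *)
Lemma wavelet_ortho l l' k k' : (l < p)%N -> (l' < p)%N -> H0 p k -> H0 p k' ->
  inner mu (shiftf k (psi l)) (shiftf k' (psi l')) = ((l, k) == (l', k'))%:R.
Proof.
move=> lp l'p k0 k'0; rewrite !shift_waveletE inner_suml//; last 2 first.
- by move=> h _; apply/L2Z/L2_fine_phi.
- by apply: L2_sum => h _; apply/L2Z/L2_fine_phi.
pose G z : R[i] := p%:R^-1 * (z == dil 1 (k' - k))%:R.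
transitivity (\sum_(h <- H0seq) \sum_(j <- H0seq)
    (beta h * zeta R (h (-1)) ^+ l) * (beta j * zeta R (j (-1)) ^+ l')^*%C * G (h - j)).
  apply: eq_big_seq => h hH; rewrite inner_sumr//; last 2 first.
  - by move=> j _; apply/L2Z/L2_fine_phi.
  - by apply/L2Z/L2_fine_phi.
  apply: eq_big_seq => j jH.
  rewrite innerZl; [|exact: L2_fine_phi|by apply: L2Z; exact: L2_fine_phi].
  rewrite innerZr; [|exact: L2_fine_phi..].
  rewrite fine_phi_ortho; try by apply: H0D; [exact: H0_dil|exact: H0seq_H0].
  rewrite mulrA; congr (_ * (_ * (nat_of_bool _)%:R)).
  rewrite dilB -[in LHS]subr_eq0 -[in RHS]subr_eq0; congr (_ == 0).
  by rewrite opprD addrACA addrC opprB.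
rewrite (beta_corr p1 N0 vt lamP m0P betaP (fun c => zeta R c ^+ l) (fun c => zeta R c ^+ l')).
  under eq_bigr do rewrite (zeta_powE _ l) (zeta_powE _ l').
  rewrite zeta_sum2// /G mulrACA mulfV ?pR_neq0// mul1r -natrM mulnb; congr (nat_of_bool _)%:R.
  rewrite xpair_eqE; congr (_ && _).
    rewrite -(inj_eq val_inj) !Zp_nat /=.
    have -> : (Zp_trunc p).+2 = p by exact: Zp_cast.
    by rewrite !modn_small.
  by rewrite eq_sym -(dil_0 p 1) (can_eq (@dilK p 1)) subr_eq0 eq_sym.
move=> z z1; rewrite /G (_ : (z == _) = false) ?mulr0//; apply/negbTE.
(* The digit of [dil 1 (k' - k)] at -1 is that of [k' - k] at 0, which vanishes on [H0]. *)
apply: contraNneq z1 => ->; rewrite digit_dil digitB.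
by move/H0P: k0 => ->//; move/H0P: k'0 => ->; rewrite ?subrr.
Qed.

(* The family [psi_l (x - h)], [0 <= l < p], is obtained from the orthogonal
   family [theta] by a unitary matrix, so inverting it costs only a conjugate
   transpose. *)
Lemma fine_phi_wavelet k x : theta k x =
  \sum_(l : 'Z_p) \sum_(j <- H0seq | j (-1) == k (-1))
    p%:R^-1 * (b l j)^*%C * shiftf (dil (-1) (k - j)) (psi l) x.
Proof.
(* With this choice of function, the value at 0 delivered by [beta_class] is [theta k x]. *)
have E := beta_class p1 N0 vt lamP m0P betaP (k (-1)) (fun z => theta (k + z) x).
rewrite -[in LHS](addr0 k) -E exchange_big [RHS]exchange_big; apply: eq_bigr => j /eqP jk.
transitivity (\sum_(h <- H0seq) \sum_(l : 'Z_p)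
    p%:R^-1 * (b l j)^*%C * (b l h * theta (k - j + h) x)); last first.
  rewrite exchange_big; apply: eq_bigr => l _.
  by rewrite shift_waveletE dilNK mulr_sumr.
rewrite big_mkcond; apply: eq_bigr => h _.
rewrite (eq_bigr (fun l : 'Z_p => p%:R^-1 * (beta h * (beta j)^*%C * theta (k + (h - j)) x) *
    (zeta R (h (-1)) ^+ l * (zeta R (j (-1)) ^+ l)^*%C))) => [|l _]; last first.
  rewrite conjcM (_ : k - j + h = k + (h - j)); last by rewrite addrAC addrA.
  move: (zeta R _ ^+ _) ((zeta R _ ^+ _)^*%C) (p%:R^-1) ((beta j)^*%C) => u v w z; ring.
rewrite -mulr_sumr zeta_sum2// jk; case: eqP => _; last by rewrite !mulr0.
by rewrite mulr1 [RHS]mulrC mulVKf ?pR_neq0.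
Qed.

Local Notation Theta := [set theta h | h in H0 p].
Local Notation D := [set lk : nat * vilenkin p | (0 < lk.1 < p)%N /\ H0 p lk.2].
Local Notation Psi := [set shiftf lk.2 (psi lk.1) | lk in D].
Local Notation Phi := [set shiftf h phi | h in H0 p].

Lemma Psi_L2 : Psi `<=` L2 mu.
Proof. by move=> _ [lk _ <-]; exact: L2_shift_wavelet. Qed.

Lemma Phi_L2 : Phi `<=` L2 mu.
Proof. by move=> _ [h _ <-]; exact: L2_shift. Qed.

(** [phi] and [psi 0] agree only almost everywhere, so one is exchanged for the other inside inner
    products. *)
Lemma inner_shift_phi h f : L2 mu f ->
  inner mu (shiftf h phi) f = inner mu (shiftf h (psi 0)) f.
Proof.
move=> Lf; have Lp : L2 mu (psi 0).
  by have := L2_shift_wavelet 0 0; congr (L2 mu _); apply/funext => x; rewrite /shiftf subr0.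
have LB := L2B Lphi Lp; have B0 : sqint mu (fun x => phi x - psi 0 x) = 0%E.
  rewrite -(phi_refine_null p1 N0 hmu hnu lamP m0P betaP Lphi phiP) //; congr sqint.
  apply/funext => x; rewrite waveletE; congr (_ - _); apply: eq_bigr => h' _.
  by rewrite expr0 mulr1.
apply/eqP; rewrite -subr_eq0 -innerBl//; [|exact: L2_shift..].
rewrite (@inner_null_l _ _ _ _ (shiftf h (fun x => phi x - psi 0 x)))//.
  exact: L2_shift.
by rewrite sqint_shift.
Qed.

Lemma Psi_Theta : Psi `<=` linear_span Theta.
Proof.
move=> _ [[l k] /= [_ k0] <-]; rewrite shift_waveletE.
apply: linear_span_sum_seq => h hH _; apply: linear_spanZ; apply: linear_span_gen.
by exists (dil 1 k + h) => //; apply: H0D; [exact: H0_dil|exact: H0seq_H0].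
Qed.

Lemma Theta_Psi :
  Theta `<=` linear_span ([set shiftf h (psi 0) | h in H0 p] `|` Psi).
Proof.
move=> _ [k k0 <-].
rewrite (funext (fine_phi_wavelet k)).
apply: linear_span_sum => l _; apply: linear_span_sum_seq => j jH /eqP jk.
apply: linear_spanZ; apply: linear_span_gen.
(* The digit at 0 of this element is that of [k - j] at -1, which vanishes since [j] is in the class
   of [k]. *)
have kj0 : H0 p (dil (-1) (k - j)).
  apply/H0P => n n0; rewrite digit_dil digitB.
  have [->|nz] := eqVneq n 0; first by rewrite sub0r jk subrr.
  move/H0P: k0 => ->; last by lia.
  by move/H0P: (H0seq_H0 jH) => ->; [rewrite subrr|lia].
have [l0|l0] := eqVneq (l : nat) 0%N; first by left; exists (dil (-1) (k - j)); rewrite ?l0.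
right; exists (l : nat, dil (-1) (k - j)) => //; split => //=.
by rewrite lt0n l0 -[X in (_ < X)%N](Zp_cast p1) ltn_ord.
Qed.

Lemma inner_phi_Psi h g : H0 p h -> closed_span mu Psi g -> inner mu (shiftf h phi) g = 0.
Proof.
move=> h0 Pg; apply: (inner_closed_span Psi_L2 _ _ Pg); first exact: L2_shift.
move=> _ [[l k] [/= /andP[l0 lp] k0] <-].
rewrite inner_shift_phi ?wavelet_ortho//; [|by lia|exact: L2_shift_wavelet].
by rewrite xpair_eqE eq_sym (gtn_eqF l0).
Qed.

(** For the converse inclusion, an approximation of [f] in the span of [Theta] splits into a part
    [g0] from [psi 0] and a part [g1] from [Psi]. Since [g0] is orthogonal to [f] and to [g1],
    dropping it does not worsen the approximation. *)
Lemma closed_span_Psi :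
  closed_span mu Psi = ortho_compl mu (closed_span mu Phi) (closed_span mu Theta).
Proof.
apply/seteqP; split => f.
  move=> Pf; have Lf : L2 mu f by case: Pf.
  split; first exact: (closed_span_sub Psi_Theta Pf).
  move=> g Pg; apply: (inner_closed_span Phi_L2 Lf _ Pg) => _ [h h0 <-].
  by rewrite (inner_conj (L2_shift hmu h Lphi) Lf) inner_phi_Psi// rmorph0.
move=> [[Lf fT] fP]; split => // e e0; have [g gT fg] := fT _ e0.
have [g0 [g1 [g0P g1P gE]]] := linear_spanU (linear_span_sub Theta_Psi gT).
have P0 : [set shiftf h (psi 0) | h in H0 p] `<=` L2 mu.
  by move=> _ [h _ <-]; exact: L2_shift_wavelet.
have Lg0 := linear_span_L2 P0 g0P; have Lg1 := linear_span_L2 Psi_L2 g1P.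
exists g1 => //; move: fg; rewrite gE !L2norm_lt//; apply: le_lt_trans.
apply: sqintB_le => //.
  apply: (inner_linear_span P0 Lf _ g0P) => _ [h h0 <-].
  rewrite (inner_conj (L2_shift_wavelet 0 h) Lf) -inner_shift_phi//.
  rewrite (inner_conj Lf (L2_shift hmu h Lphi)) fP ?rmorph0//.
  by apply: (closed_span_gen Phi_L2); exists h.
apply: (inner_linear_span P0 Lg1 _ g0P) => _ [h h0 <-].
rewrite (inner_conj (L2_shift_wavelet 0 h) Lg1) -inner_shift_phi// inner_phi_Psi ?rmorph0//.
split => // d d0; exists g1 => //; rewrite L2norm_lt//; under eq_fun do rewrite subrr.
rewrite /sqint integral0_eq ?lte_fin ?exprn_gt0// => x _.
by rewrite /normsq /= expr0n addr0.
Qed.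

Lemma wavelet_basis : orthonormal_basis mu D (fun lk => shiftf lk.2 (psi lk.1))
  (ortho_compl mu (closed_span mu Phi) (closed_span mu Theta)).
Proof.
rewrite -closed_span_Psi; split => //; first exact: (closed_span_gen Psi_L2).
move=> [l k] [l' k'] [/andP[_ lp] k0] [/andP[_ l'p] k'0].
exact: wavelet_ortho.
Qed.

End Wavelets.

Theorem theorem5p1 (R : realType) (p N : nat)
    (mu : {measure set (vilenkin p) -> \bar R})
    (nu : {measure set (character R p) -> \bar R})
    (t : ltree 'Z_p) (lam : N.+1.-tuple 'Z_p -> R[i])
    (m0 : character R p -> R[i]) (phi beta : vilenkin p -> R[i]) :
  prime p -> (0 < N)%N ->
  haar_vilenkin mu -> haar_character nu ->
  valid_tree N t -> mask_values t lam -> is_mask lam m0 ->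
  L2 mu phi -> is_fourier mu nu phi (scaling_hat m0) ->
  mask_coefs N m0 beta ->
  orthonormal_basis mu
    [set lh : nat * vilenkin p | (0 < lh.1 < p)%N /\ H0 p lh.2]
    (fun lh x => wavelet N beta phi lh.1 (x - lh.2))
    (ortho_compl mu (mra_space mu phi 0) (mra_space mu phi 1)).
Proof.
move=> /prime_gt1 p1 N0 hmu hnu vt lamP m0P Lphi phiP betaP.
have := wavelet_basis p1 N0 hmu hnu vt lamP m0P betaP Lphi phiP.
congr (orthonormal_basis _ _ _ (ortho_compl _ (closed_span _ _) _)).
by apply/seteqP; split => _ [h h0 <-]; exists h => //; apply/funext => x;
  rewrite /shiftf dil0.
Qed.
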